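(* Let $(W_{i,j})_{i\sim j}$ be positive symmetric conductances on the nearest-neighbour edges of $\mathbb{Z}^2$ that are uniformly bounded: $W_{i,j}\le \overline{W}<\infty$ for all $i\sim j$, $i,j\in\mathbb{Z}^2$. Then, for every $0<s<1$, there exists $\eta=\eta(\overline{W},s)>0$ (depending only on $\overline{W}$ and $s$) such that for all $N\in\mathbb{N}$ large enough and for all $y\in V_N=\mathbb{Z}^2\cap[-N,N]^2$ with $y\neq 0$, $$\mathbb{E}^{\mathbb{Q}^N}\left(e^{s u_y}\right)\le |y|_\infty^{-\eta},$$ where $\mathbb{Q}^N$ is the mixing field, rooted at $i_0=0$, on the wired box $\mathcal{G}_N$ with conductances $W^N$.
   Context: The lattice: $\mathbb{Z}^2$ is endowed with edges $\{i,j\}$ whenever $|i-j|_1=1$, written $i\sim j$; conductances satisfy $W_{i,j}=W_{j,i}>0$. $|y|_\infty$ denotes the sup norm. Wired box: for a positive integer $N$, $V_N=\mathbb{Z}^2\cap[-N,N]^2$. The finite graph $\mathcal{G}_N=(\tilde V_N,\tilde E_N)$ has vertex set $\tilde V_N=V_N\cup\{\delta_N\}$ and is obtained from $\mathbb{Z}^2$ by contracting all vertices of $\mathbb{Z}^2\setminus V_N$ to the single point $\delta_N$, removing all loops created, and identifying multiple edges. The conductance $W^N_e$ of an edge $e\in\tilde E_N$ is the sum of the conductances of the edges of $\mathbb{Z}^2$ mapped to $e$ by the contraction. Mixing field: let $\mathcal{G}=(V,E)$ be a finite connected undirected graph with positive conductances $W_{i,j}=W_{j,i}$ on edges $\{i,j\}\in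 E$, and let $i_0\in V$. Let $\vec E$ be the set of directed edges (each undirected edge gives two directed edges with opposite orientations), and $\sum_{i\to j}$ denote the sum over $(i,j)\in\vec E$. For $u:V\to\mathbb{R}$ put $\nabla u_{i,j}=u_j-u_i$. The measure $\mathbb{Q}^W_{i_0}$ on $\{(u_i)_{i\in V}: u_{i_0}=0\}$ is $$\mathbb{Q}^W_{i_0}(du)=c_V\, e^{-\frac12\sum_{i\to j}W_{i,j}(e^{\nabla u_{i,j}}-1)}\sqrt{D_{i_0}(W,u)}\prod_{i\ne i_0}du_i,\qquad c_V=(2\pi)^{-(|V|-1)/2},$$ $$D_{i_0}(W,u)=\sum_{T\in\mathcal{T}_{i_0}}\prod_{(i,j)\in T}W_{i,j}e^{\nabla u_{i,j}},$$ where $\mathcal{T}_{i_0}$ is the set of directed spanning trees oriented towards the root $i_0$. It is known that $\mathbb{Q}^W_{i_0}$ is a probability measure. $\mathbb{Q}^N$ denotes $\mathbb{Q}^{W^N}_{0}$ for the graph $\mathcal{G}_N$ with conductances $W^N$ and root $i_0=0$, and $\mathbb{E}^{\mathbb{Q}^N}$ is integration against it. *)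

(* Defs.v *)
From HB Require Import structures.
From mathcomp Require Import all_boot all_order all_algebra finmap.
From mathcomp Require Import all_classical all_reals all_analysis.
From mathcomp Require Import measurable_realfun zify.

Set Implicit Arguments.
Unset Strict Implicit.
Unset Printing Implicit Defensive.

Import Order.TTheory GRing.Theory Num.Theory.
Import numFieldNormedType.Exports.

Local Open Scope classical_set_scope.
Local Open Scope ring_scope.

Section lebesgue_cons.
Context (R : realType) (n : nat).
Local Notation mu1 := (@lebesgue_measure R).
Variable mu : {sigma_finite_measure set (n.-tuple R) -> \bar R}.

Let consT (p : R * n.-tuple R) : n.+1.-tuple R := [tuple of p.1 :: p.2].

Let measurable_consT : measurable_fun setT consT.
Proof. exact: measurable_cons. Qed.

Let preimage_measurable (A : set (n.+1.-tuple R)) :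
  measurable A -> measurable (consT @^-1` A).
Proof. by move=> mA; rewrite -[X in measurable X]setTI; exact: measurable_consT. Qed.

Definition lebesgue_cons : set (n.+1.-tuple R) -> \bar R :=
  pushforward (mu1 \x mu)%E consT.

Let lebesgue_cons0 : lebesgue_cons set0 = 0%E.
Proof. by rewrite /lebesgue_cons /pushforward preimage_set0 measure0. Qed.

Let lebesgue_cons_ge0 A : (0 <= lebesgue_cons A)%E.
Proof. exact: measure_ge0. Qed.

Let lebesgue_cons_sigma_additive : semi_sigma_additive lebesgue_cons.
Proof.
move=> F mF tF mUF; rewrite /lebesgue_cons /pushforward preimage_bigcup.
apply: measure_semi_sigma_additive.
- by move=> i; exact: preimage_measurable.
- apply/trivIsetP => /= i j _ _ ij; rewrite -preimage_setI.
  by move/trivIsetP : tF => /(_ _ _ _ _ ij) ->//; rewrite preimage_set0.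
- by rewrite -preimage_bigcup; exact: preimage_measurable.
Qed.

HB.instance Definition _ := isMeasure.Build _ _ _ lebesgue_cons
  lebesgue_cons0 lebesgue_cons_ge0 lebesgue_cons_sigma_additive.

Lemma lebesgue_consE (A : set R) (B : set (n.-tuple R)) :
  measurable A -> measurable B ->
  lebesgue_cons [set t | A (thead t) /\ B [tuple of behead t]] =
  (mu1 A * mu B)%E.
Proof.
move=> mA mB; rewrite -product_measure1E// /lebesgue_cons /pushforward.
have consTE (a : R) (t : n.-tuple R) :
    (thead (consT (a, t)) = a) * ([tuple of behead (consT (a, t))] = t).
  by split; [rewrite /thead (tnth_nth a)|exact/val_inj].
by congr (_ _); apply/seteqP; split => -[a t] /=; rewrite !consTE.
Qed.

Let lebesgue_cons_sigma_finite : sigma_finite setT lebesgue_cons.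
Proof.
have /sigma_finiteP[F [TF ndF Foo]] := sigma_finiteT mu1.
have /sigma_finiteP[G [TG ndG Goo]] := sigma_finiteT mu.
exists (fun k => [set t | F k (thead t) /\ G k [tuple of behead t]]).
  apply/seteqP; split => // t _ /=.
  have [i _ Fi] : (\bigcup_i F i) (thead t) by rewrite -TF.
  have [j _ Gj] : (\bigcup_j G j) [tuple of behead t] by rewrite -TG.
  exists (maxn i j) => //=; split.
    by move: Fi; exact/subsetPset/ndF/leq_maxl.
  by move: Gj; exact/subsetPset/ndG/leq_maxr.
move=> k; have [? ?] := Foo k; have [? ?] := Goo k; split.
  rewrite (_ : mkset _ = (fun t : n.+1.-tuple R => tnth t ord0) @^-1` F k `&`
    (fun t : n.+1.-tuple R => [tuple of behead t]) @^-1` G k)//.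
  apply: measurableI; rewrite -[X in measurable X]setTI.
    exact: measurable_tnth.
  exact: measurable_behead.
by rewrite lebesgue_consE// lte_mul_pinfty// ge0_fin_numE.
Qed.

HB.instance Definition _ := Measure_isSigmaFinite.Build _ _ _ lebesgue_cons
  lebesgue_cons_sigma_finite.

End lebesgue_cons.

(* Lebesgue measure on R^n. *)
Fixpoint lebesgue_tuple (R : realType) (n : nat) :
    {sigma_finite_measure set (n.-tuple R) -> \bar R} :=
  if n is m.+1 then lebesgue_cons (lebesgue_tuple R m) : sigma_finite_measure _ _
  else (\d_([tuple] : 0.-tuple R)) : sigma_finite_measure _ _.

Section mixing_field.
Context (R : realType) (V : finType).
(* [e] is the adjacency relation, [W] the conductances (only their values on
   adjacent pairs matter) and [i0] the root. *)
Variables (e : rel V) (W : V -> V -> R) (i0 : V).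

Definition directed_edges : {set V * V} := [set p | e p.1 p.2]%SET.

(* Directed spanning trees oriented towards the root, i.e. sets of directed edges
   in which every vertex is joined to the root by exactly one directed walk;
   for [i = i0] this is the empty walk, so that no edge leaves the root. *)
Definition spanning_trees : {set {set V * V}} :=
  [set T : {set V * V} | (T \subset directed_edges) &&
    `[< forall i, exists! w : seq V,
          path (fun a b => (a, b) \in T) i w /\ last i w = i0 >]]%SET.

Definition tree_sum (u : V -> R) : R :=
  \sum_(T in spanning_trees) \prod_(p in T) (W p.1 p.2 * expR (u p.2 - u p.1)).

Definition mixing_density (u : V -> R) : R :=
  (2 * pi) `^ (- ((#|V|.-1)%:R / 2)) *
  expR (- (2^-1 * \sum_(p in directed_edges)
                    W p.1 p.2 * (expR (u p.2 - u p.1) - 1))) *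
  Num.sqrt (tree_sum u).

Definition free_vertex : finType := {i : V | i != i0}.

(* A field vanishing at the root is encoded by the tuple of its values at the
   other vertices; the order of the coordinates is immaterial. *)
Definition field_of (t : #|free_vertex|.-tuple R) (i : V) : R :=
  if insub i is Some j then tnth t (enum_rank (j : free_vertex)) else 0.

Lemma field_of_root t : field_of t i0 = 0.
Proof. by rewrite /field_of insubF// eqxx. Qed.

Lemma measurable_field_of i : measurable_fun setT (field_of ^~ i).
Proof.
rewrite /field_of; case: insubP => [j _ _|_]; last exact: measurable_cst.
exact: measurable_tnth.
Qed.

Lemma measurable_mixing_density :
  measurable_fun setT (mixing_density \o field_of).
Proof.
have mgrad i j : measurable_fun setT
    (fun t => expR (field_of t j - field_of t i)).
  apply: measurableT_comp => //.
  by apply: measurable_funB; exact: measurable_field_of.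
apply: measurable_funM.
  apply: measurable_funM; first exact: measurable_cst.
  apply: measurableT_comp => //; apply: measurableT_comp => //.
  apply: measurable_funM; first exact: measurable_cst.
  rewrite [X in measurable_fun _ X](_ : _ = fun t =>
    \sum_(p <- enum directed_edges)
      W p.1 p.2 * (expR (field_of t p.2 - field_of t p.1) - 1)); last first.
    by apply/funext => t; rewrite big_enum.
  apply: measurable_sum => p; apply: measurable_funM => //.
  by apply: measurable_funB.
have msqrt : measurable_fun setT (@Num.sqrt R).
  by apply: continuous_measurable_fun; exact: sqrt_continuous.
apply: (measurableT_comp msqrt).
rewrite /tree_sum [X in measurable_fun _ X](_ : _ = fun t =>
  \sum_(T <- enum spanning_trees) \prod_(p <- enum T)
     (W p.1 p.2 * expR (field_of t p.2 - field_of t p.1))); last first.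
  by apply/funext => t; rewrite big_enum; apply: eq_bigr => T _; rewrite big_enum.
apply: measurable_sum => T; apply: measurable_prod => p _.
exact: measurable_funM.
Qed.

Lemma mixing_density_ge0 u : 0 <= mixing_density u.
Proof. by rewrite /mixing_density !mulr_ge0// ?powR_ge0 ?expR_ge0 ?sqrtr_ge0. Qed.

Definition mixing_field (A : set (#|free_vertex|.-tuple R)) : \bar R :=
  (\int[lebesgue_tuple R #|free_vertex|]_(t in A)
     (mixing_density (field_of t))%:E)%E.

Let mixing_field0 : mixing_field set0 = 0%E.
Proof. exact: integral_set0. Qed.

Let mixing_field_ge0 A : (0 <= mixing_field A)%E.
Proof. by apply: integral_ge0 => t _; rewrite lee_fin mixing_density_ge0. Qed.

Let mixing_field_sigma_additive : semi_sigma_additive mixing_field.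
Proof.
move=> F mF tF mUF; rewrite /mixing_field; apply: cvg_toP.
  apply: ereal_nondecreasing_is_cvgn => m n mn.
  by apply: lee_sum_nneg_natr => // k _ _; exact: mixing_field_ge0.
rewrite ge0_integral_bigcup//=.
- apply/measurable_funTS/measurableT_comp => //.
  exact: measurable_mixing_density.
- by move=> t _; rewrite lee_fin mixing_density_ge0.
Qed.

HB.instance Definition _ := isMeasure.Build _ _ _ mixing_field
  mixing_field0 mixing_field_ge0 mixing_field_sigma_additive.

End mixing_field.

Arguments mixing_field {R V} e W i0 A.

Notation Z2 := (int * int)%type.

Definition neighbor : rel Z2 :=
  fun i j => (`|i.1 - j.1| + `|i.2 - j.2| == 1)%N.

Definition sup_norm (i : Z2) : nat := maxn `|i.1|%N `|i.2|%N.

Definition box (N : nat) : {fset Z2} :=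
  let s : seq int := [seq k%:Z - N%:Z | k <- iota 0 N.*2.+1] in
  [fset ((a, b) : Z2) | a in s, b in s]%fset.

Lemma in_box N i : (i \in box N) = (sup_norm i <= N)%N.
Proof.
have in_s (a : int) : (a \in [seq k%:Z - N%:Z | k <- iota 0 N.*2.+1]) =
    (`|a| <= N)%N.
  apply/mapP/idP => [[k]|aN].
    by rewrite mem_iota => /andP[_ kN] ->; lia.
  by exists (absz (a + N%:Z)); rewrite ?mem_iota; lia.
rewrite /sup_norm geq_max -!in_s; apply/imfset2P/andP => /=.
  by move=> [a ain [b bin ->]].
by case: i => a b /= [ain bin]; exists a => //; exists b.
Qed.

Section wired_box.
Context (R : realType) (N : nat) (W : Z2 -> Z2 -> R).

(* [None] is the point to which the complement of the box is contracted. *)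
Definition wired_vertex : finType := option (box N).

Definition wired_proj (i : Z2) : wired_vertex := insub i.

Definition wired_edge : rel wired_vertex := fun a b => (a != b) &&
  `[< exists i j, [/\ neighbor i j, wired_proj i = a & wired_proj j = b] >].

(* For [a != b], each unoriented edge contracted to [{a, b}] is counted once,
   with its orientation from [a] to [b], and there are finitely many of them. *)
Definition wired_conductance (a b : wired_vertex) : R :=
  \sum_(p \in [set p : Z2 * Z2 |
          [/\ neighbor p.1 p.2, wired_proj p.1 = a & wired_proj p.2 = b]])
    W p.1 p.2.

Definition wired_field : set (#|free_vertex (wired_proj 0)|.-tuple R) -> \bar R :=
  mixing_field wired_edge wired_conductance (wired_proj 0).

HB.instance Definition _ := Measure.on wired_field.

End wired_box.

Arguments wired_field {R} N W A.

(* Main.v *)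
Require Import Defs.
From mathcomp Require Import all_boot all_order all_algebra finmap.
From mathcomp Require Import all_classical all_reals all_analysis.
From mathcomp Require Import perm measurable_realfun ring lra zify.

(** Write Q^W_0 = p^W(u) du for the mixing field, h for a function on the
    vertices with h(0) = 0, and q = s / (1 - s).  The theorem is a deformation
    argument of Mermin-Wagner type, in which the quadratic cost of the deformation
    is paid by changing the conductances instead of being estimated in mean.

    Deformation.  The point u is the barycentre of u + h and u - q h with weights
    s and 1 - s, and log p^W is a concave function of u apart from the term
    (1/2) log D, which is convex, being the logarithm of a sum of exponentials of
    linear forms.  The convexity of log D is exactly what is wanted:
    D(u) <= D(u + h)^s D(u - q h)^(1-s).  In the exponent, the barycentre of
    e^(grad (u + h)) and e^(grad (u - q h)) is at most 1 + r times e^(grad u), where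
    r = 2 q (grad h)^2, because the terms of first order in h cancel; this factor is
    absorbed by replacing W by W' = W / (1 + r).  The change of
    conductances costs a factor e^(r W / 2) per directed edge in the exponential
    and at most e^(r / 2) per directed edge in the square root of D.  Altogether
    ([mixing_density_deformation_le])
      e^(s u_y) p^W(u) <=
        K e^(- s h_y) (e^(u_y + h_y) p^W'(u + h))^s (p^W'(u - q h))^(1-s),
      K = exp (sum over directed edges of q (W + 1) (grad h)^2),
    and the last product is at most the corresponding barycentre.  After a
    translation of u both integrals are at most 1, provided that p^W' and
    e^(u_y) p^W' have integral at most 1; this gives
    E(e^(s u_y)) <= K e^(- s h_y) ([le_integral_mixing_field]).

    Choice of h.  With h(x) = c (1 + 1/2 + ... + 1/m), m = min(|x|, |y|), the
    energy of h is of order c^2 log |y| because a sphere of radius k of the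
    lattice has of order k points, whereas h_y is about c log |y|.  For small c
    the linear gain s h_y wins.  The edges at the wired point join vertices with the
    same value of h, so that K involves edges of the lattice only, with W bounded.

    Normalization.  It remains to prove that the integrals of p^W and of
    e^(u_y) p^W are at most 1, for arbitrary nonnegative symmetric conductances.
    By the matrix-tree theorem ([det_laplacian_sum]) D is a minor of the
    Laplacian with weights W_ij e^(u_j - u_i).  Vertices are then eliminated one
    by one ([le_integral_weighted_density]): if z is the first free vertex,
    a = sum_j W_zj, and u_z is replaced by the variable v such that
    a e^v = sum_j W_zj e^(u_j - u_z), then the remaining coordinates have, for
    fixed v, the density of the same model without z and with the conductances
    W_ij + W_iz W_zj e^(-v) / a (a Schur complement), times a density of v alone
    which is that of the logarithm of a reciprocal inverse Gaussian variable. *)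

Set Implicit Arguments.
Unset Strict Implicit.
Unset Printing Implicit Defensive.

Import Order.TTheory GRing.Theory Num.Theory.
Import numFieldNormedType.Exports.

Local Open Scope classical_set_scope.
Local Open Scope ring_scope.

(** * Integration *)

Lemma lebesgue_measure_reflection (R : realType) (c : R) (A : set R) :
  measurable A ->
  pushforward lebesgue_measure
    ((fun x => c - x) : measurableTypeR R -> measurableTypeR R) A =
  lebesgue_measure A.
Proof.
move=> mA.
have mr : measurable_fun setT
    ((fun x => c - x) : measurableTypeR R -> measurableTypeR R).
  exact: measurable_funB.
apply/esym; apply: lebesgue_measure_unique => //= _ [[a b]] _ <-.
rewrite /pushforward /=.
have -> : (fun x : R => c - x) @^-1` `]a, b]%classic = `[c - b, c - a[%classic.
  apply/seteqP; split => x /=; rewrite !in_itv/= => /andP[h1 h2]; lra.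
by rewrite !lebesgue_measure_itv/= !lte_fin; congr (if _ then _ else _);
  [lra | congr EFin; lra].
Qed.

Lemma ge0_integral_reflection (R : realType) (c : R) (f : R -> \bar R) :
  measurable_fun [set: R] f -> (forall r, (0 <= f r)%E) ->
  (\int[lebesgue_measure]_x f x = \int[lebesgue_measure]_x f (c - x)%R)%E.
Proof.
move=> mf f0.
have mr : measurable_fun setT
    ((fun x => c - x) : measurableTypeR R -> measurableTypeR R).
  exact: measurable_funB.
transitivity (\int[pushforward lebesgue_measure
   ((fun x => (c - x)%R) : measurableTypeR R -> measurableTypeR R)]_x f x)%E.
  apply: eq_measure_integral => A mA _; exact/esym/lebesgue_measure_reflection.
by rewrite ge0_integral_pushforward.
Qed.

Section with_density.
Import HBNNSimple.

Lemma ge0_integral_with_density d (T : measurableType d) (R : realType)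
    (mu nu : {measure set T -> \bar R}) (g : T -> R) (f : T -> \bar R) :
  measurable_fun setT g -> (forall x, 0 <= g x) ->
  (forall A, measurable A -> nu A = \int[mu]_(x in A) (g x)%:E)%E ->
  measurable_fun setT f -> (forall x, 0 <= f x)%E ->
  (\int[nu]_x f x = \int[mu]_x (f x * (g x)%:E))%E.
Proof.
move=> mg g0 nuE mf f0.
have mgE : measurable_fun setT (EFin \o g) by exact/measurable_EFinP.
pose h := nnsfun_approx measurableT mf.
have hf x : (fun n => (h n x)%:E) @ \oo --> f x by exact: cvg_nnsfun_approx.
have h_nd x : {homo (fun n => (h n x)%:E) : m n / (m <= n)%N >-> (m <= n)%E}.
  by move=> m n mn; rewrite lee_fin; exact/lefP/nd_nnsfun_approx.
rewrite (eq_integral (fun x => limn (fun n => (h n x)%:E))); last first.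
  by move=> x _; apply/esym/cvg_lim => //; exact: hf.
rewrite [RHS](eq_integral (fun x => limn (fun n => (h n x)%:E * (g x)%:E)%E));
  last by move=> x _; apply/esym/cvg_lim => //; apply: cvgeZr => //; exact: hf.
rewrite monotone_convergence//; last 2 first.
- by move=> n; exact/measurable_EFinP.
- by move=> n x _; rewrite lee_fin.
rewrite monotone_convergence//; last 3 first.
- by move=> n; apply: emeasurable_funM => //; exact/measurable_EFinP.
- by move=> n x _; rewrite mule_ge0 ?lee_fin.
- by move=> x _ m n mn; rewrite lee_wpmul2r ?lee_fin//; exact/lefP/nd_nnsfun_approx.
congr (limn _); apply/funext => n.
have mi y : measurable_fun setT (fun x => (y * \1_(h n @^-1` [set y]) x)%:E).
  exact/measurable_EFinP/measurable_funM.
transitivity (\int[nu]_x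
    (\sum_(y \in range (h n)) (y * \1_(h n @^-1` [set y]) x)%:E))%E.
  by apply: eq_integral => x _; rewrite fimfunE -fsumEFin.
rewrite ge0_integral_fsum//; last by move=> y x _; exact: nnfun_muleindic_ge0.
transitivity (\int[mu]_x (\sum_(y \in range (h n))
    ((y * \1_(h n @^-1` [set y]) x)%:E * (g x)%:E)))%E; last first.
  apply: eq_integral => x _; rewrite -ge0_mule_fsuml => [|y]; last first.
    exact: nnfun_muleindic_ge0.
  by rewrite fsumEFin // -(fimfunE _ x).
rewrite ge0_integral_fsum//; last 2 first.
- by move=> y; exact: emeasurable_funM.
- by move=> y x _; rewrite mule_ge0 ?lee_fin// -lee_fin nnfun_muleindic_ge0.
apply: eq_fsbigr => r; rewrite inE => -[t _ rE].
under eq_integral do rewrite EFinM.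
rewrite integralZl_indic_nnsfun//.
under [RHS]eq_integral do rewrite EFinM -muleA.
have r0 : (0 <= r%:E)%E by rewrite -rE lee_fin.
rewrite [RHS]ge0_integralZl//.
- congr (_ * _)%E; rewrite integral_indic// setIT nuE//.
  rewrite integral_mkcond; apply: eq_integral => x _.
  by rewrite epatch_indic muleC.
- by apply: emeasurable_funM => //; exact/measurable_EFinP.
- by move=> x _; rewrite mule_ge0 ?lee_fin.
Qed.

End with_density.

Lemma measurable_cons_pair (R : realType) n :
  measurable_fun setT
    (fun p : R * n.-tuple R => [the n.+1.-tuple R of p.1 :: p.2]).
Proof. exact: measurable_cons. Qed.

(** The head of the tuple is the inner variable, so that it can be substituted
    while the other coordinates are fixed. *)
Lemma ge0_integral_lebesgue_tupleS (R : realType) n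
    (F : n.+1.-tuple R -> \bar R) :
  measurable_fun setT F -> (forall t, 0 <= F t)%E ->
  (\int[lebesgue_tuple R n.+1]_t F t =
   \int[lebesgue_tuple R n]_t \int[lebesgue_measure]_x F [tuple of x :: t])%E.
Proof.
move=> mF F0.
rewrite [LHS](_ : _ = \int[pushforward (lebesgue_measure \x lebesgue_tuple R n)
  (fun p : R * n.-tuple R => [tuple of p.1 :: p.2])]_t F t)%E; last first.
  have mc := @measurable_cons_pair R n.
  by apply: (@eq_measure_integral _ _ _ _ (lebesgue_tuple R n.+1)) => A mA _.
rewrite ge0_integral_pushforward//; last exact: measurable_cons_pair.
rewrite preimage_setT fubini_tonelli2//; last by move=> p; exact: F0.
apply: measurableT_comp => //; exact: measurable_cons_pair.
Qed.

Definition tuple_add (R : realType) n (t u : n.-tuple R) : n.-tuple R :=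
  [tuple tnth t i + tnth u i | i < n].

Lemma measurable_tuple_addr (R : realType) n (u : n.-tuple R) :
  measurable_fun setT (@tuple_add R n ^~ u).
Proof.
apply/measurable_fun_tnthP => i.
rewrite (_ : _ \o _ = fun t => tnth t i + tnth u i); last first.
  by apply/funext => t /=; rewrite tnth_mktuple.
by apply: measurable_funD => //; exact: measurable_tnth.
Qed.

Lemma ge0_integral_translation (R : realType) (c : R) (f : R -> \bar R) :
  measurable_fun [set: R] f -> (forall r, (0 <= f r)%E) ->
  (\int[lebesgue_measure]_x f (x + c)%R = \int[lebesgue_measure]_x f x)%E.
Proof.
move=> mf f0; rewrite [RHS](ge0_integral_reflection c)//.
rewrite (@ge0_integral_reflection _ 0 (fun x => f (x + c)))//.
  by apply: eq_integral => x _; rewrite sub0r addrC.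
by apply: measurableT_comp => //; exact: measurable_funD.
Qed.

Lemma ge0_integral_tuple_translation (R : realType) n (u : n.-tuple R)
    (F : n.-tuple R -> \bar R) :
  measurable_fun setT F -> (forall t, 0 <= F t)%E ->
  (\int[lebesgue_tuple R n]_t F (tuple_add t u) =
   \int[lebesgue_tuple R n]_t F t)%E.
Proof.
elim: n u F => [|n IH] u F mF F0.
  by apply: eq_integral => t _; congr F; rewrite [LHS]tuple0 [RHS]tuple0.
have mcons (t : n.-tuple R) : measurable_fun setT (fun x : R => F [tuple of x :: t]).
  by apply: (measurableT_comp mF) => /=; apply: measurable_cons.
rewrite !ge0_integral_lebesgue_tupleS//; last first.
  by apply: (measurableT_comp mF); exact: measurable_tuple_addr.
case/tupleP: u => c u.
rewrite -[RHS](IH u); last 2 first.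
- apply: (@measurable_fun_fubini_tonelli_G _ _ _ _ _ lebesgue_measure
    (fun p : R * n.-tuple R => F [tuple of p.1 :: p.2])) => [|p]; last exact: F0.
  by apply: measurableT_comp => //; exact: measurable_cons_pair.
- by move=> t; apply: integral_ge0.
apply: eq_integral => t _.
rewrite -[RHS](ge0_integral_translation c)//.
apply: eq_integral => x _; congr F; apply: eq_from_tnth => i.
rewrite tnth_mktuple; case: (unliftP ord0 i) => [j|] ->.
  by rewrite !tnthS tnth_mktuple.
by rewrite !tnth0.
Qed.

(** An inequality only: exhausting the line by the intervals [-n, n] then asks
    nothing of [F] and [f] at infinity, where the derivative of a hyperbolic sine
    diverges. *)
Lemma le_integral_increasing_substitution (R : realType) (F f G : R -> R) :
  {homo F : x y / x < y} -> (forall x, is_derive x (1 : R) F (f x)) ->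
  continuous f -> (forall x, 0 <= f x) ->
  continuous G -> (forall x, 0 <= G x) ->
  (\int[lebesgue_measure]_x (G (F x) * f x)%:E <=
   \int[lebesgue_measure]_x (G x)%:E)%E.
Proof.
move=> F_incr F' f_cont f0 G_cont G0.
have F_cont : continuous F.
  by move=> x; apply: differentiable_continuous; apply/derivable1_diffP.
have F'E : F^`()%classic = f.
  by apply/funext => x; rewrite derive1E derive_val.
have mG : measurable_fun setT (EFin \o G).
  by apply/measurable_EFinP; exact: continuous_measurable_fun.
have mGF : measurable_fun setT (fun x => (G (F x) * f x)%:E).
  apply/measurable_EFinP; apply: continuous_measurable_fun => x.
  apply: continuousM; last exact: f_cont.
  by apply: continuous_comp; [exact: F_cont | exact: G_cont].
pose D n := `[(- n%:R : R), n%:R]%classic.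
have nndD : nondecreasing_seq D.
  move=> m n mn; apply/subsetPset; apply: subset_itv; rewrite bnd_simp.
    by rewrite lerN2 ler_nat.
  by rewrite ler_nat.
have cvgD : (\int[lebesgue_measure]_(x in D n) (G (F x) * f x)%:E)%E
    @[n --> \oo] -->
    (\int[lebesgue_measure]_(x in \bigcup_n D n) (G (F x) * f x)%:E)%E.
  apply: ge0_nondecreasing_set_cvg_integral => //.
  - by move=> n; exact: measurable_itv.
  - by move=> n; exact: measurable_funTS.
  - by move=> n x _; rewrite lee_fin mulr_ge0.
rewrite bigcup_itvT in cvgD; rewrite -(cvg_lim _ cvgD)//.
apply: lime_le; first by apply/cvg_ex; eexists; exact: cvgD.
apply: nearW => n.
have n0 : (- n%:R : R) <= n%:R by rewrite ge0_cp.
have := @integration_by_substitution_increasing _ F G (- n%:R) n%:R n0.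
rewrite F'E => <-.
- by apply: ge0_subset_integral => // x _; rewrite lee_fin.
- by move=> x y _ _; exact: F_incr.
- by move=> x _; exact: f_cont.
- apply/cvg_ex; exists (f (- n%:R)).
  exact/cvg_at_right_filter/f_cont.
- apply/cvg_ex; exists (f n%:R).
  exact/cvg_at_left_filter/f_cont.
- split=> [x _||]; first by [].
    exact/cvg_at_right_filter/F_cont.
  exact/cvg_at_left_filter/F_cont.
- exact: continuous_subspaceT.
Qed.

(** * The inverse Gaussian integral *)

(** In the variable [b = a e^v] the measure [half (1/2) v dv] is the reciprocal
    inverse Gaussian measure, with density
    [b ^ (-1/2) * exp (- (b - 2 a + a ^ 2 / b) / 2)].  The reflection of [v] exchanges [half (1/2)] and [half (-1/2)], and their sum is a Gaussian weight
    in the variable [F v], a multiple of [sinh (v / 2)]. *)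
Section inverse_gaussian.
Context (R : realType) (a : R).
Hypothesis a0 : 0 < a.

Let F (v : R) : R := Num.sqrt (a / 2) * (expR (v / 2) - expR (- (v / 2))).
Let f (v : R) : R :=
  Num.sqrt (a / 2) * (2^-1 * (expR (v / 2) + expR (- (v / 2)))).
Let E (v : R) : R := expR (- (a / 2 * (expR v + expR (- v) - 2))).

Let sqr_half (v : R) : expR (v / 2) ^+ 2 = expR v.
Proof. by rewrite -expRM_natl; congr expR; field. Qed.

Let FE v : gauss_fun (F v) = E v.
Proof.
rewrite /gauss_fun /F /E; congr (expR (- _)).
rewrite exprMn sqr_sqrtr; last by rewrite divr_ge0// ltW.
congr (_ * _); rewrite sqrrB expRxMexpNx_1 sqr_half -[- (v / 2)]mulNr sqr_half; ring.
Qed.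

Let F_deriv v : is_derive v (1 : R) F (f v).
Proof.
have dE c : is_derive v (1 : R) (fun x => expR (c * x)) (expR (c * v) * c).
  apply: is_derive1_comp.
  by apply: is_derive_eq; rewrite scaler1.
have -> : F = Num.sqrt (a / 2) \*: ((fun x => expR (2^-1 * x)) -
                                    (fun x => expR (- 2^-1 * x))).
  apply/funext => x; rewrite /F [LHS]/= [RHS]/GRing.scale /=; congr (_ * _).
  rewrite [RHS]/GRing.add/= /GRing.opp/= mulNr [2^-1 * x]mulrC.
  by [].
apply: is_derive_eq; rewrite /f /GRing.scale/= !mulNr ![2^-1 * v]mulrC.
by congr (_ * _); ring.
Qed.

Let F_incr : {homo F : x y / x < y}.
Proof.
move=> x y xy; rewrite /F ltr_pM2l ?sqrtr_gt0 ?divr_gt0//.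
by rewrite ltrD// ?ltrN2 ltr_expR ?ltrN2 ltr_pM2r.
Qed.

Let f_cont : continuous f.
Proof.
have c2 : continuous (fun v : R => v / 2) by exact: mulrr_continuous.
move=> v; apply: cvgM; first exact: cvg_cst.
apply: cvgM; first exact: cvg_cst.
have cN : continuous (fun v : R => - (v / 2)).
  rewrite (_ : (fun _ => _) = *%R^~ (- 2^-1)); first exact: mulrr_continuous.
  by apply/funext => x /=; rewrite mulrN.
apply: cvgD.
  exact: (continuous_comp (c2 v) (@continuous_expR R (v / 2))).
exact: (continuous_comp (cN v) (@continuous_expR R (- (v / 2)))).
Qed.

Let f_ge0 v : 0 <= f v.
Proof. by rewrite mulr_ge0 ?sqrtr_ge0// mulr_ge0// addr_ge0 ?expR_ge0. Qed.

Let E_ge0 v : 0 <= E v. Proof. exact: expR_ge0. Qed.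

Let mexpV c : measurable_fun setT (fun v : R => expR (c * v)).
Proof. by apply: measurableT_comp => //; exact: measurable_funM. Qed.

Let mE : measurable_fun setT E.
Proof.
apply: measurableT_comp => //; apply: measurableT_comp => //.
apply: measurable_funM => //; apply: measurable_funB => //.
by apply: measurable_funD => //; exact: measurableT_comp.
Qed.

Let half (c v : R) := Num.sqrt a * expR (c * v) * E v.

Let mhalf c : measurable_fun setT (half c).
Proof. by apply: measurable_funM => //; apply: measurable_funM. Qed.

Let half_ge0 c v : 0 <= half c v.
Proof. by rewrite /half !mulr_ge0 ?sqrtr_ge0 ?expR_ge0. Qed.

Let le_sum_half :
  (\int[lebesgue_measure]_v (half 2^-1 v + half (- 2^-1) v)%:E <=
   (2 * Num.sqrt (2 * pi))%:E)%E.
Proof.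
have sumE v : half 2^-1 v + half (- 2^-1) v =
    2 * Num.sqrt 2 * (gauss_fun (F v) * f v).
  rewrite FE /half /f.
  rewrite sqrtrM; last exact: ltW.
  rewrite sqrtrV// !mulNr ![2^-1 * v]mulrC.
  have s2 : Num.sqrt (2 : R) != 0 by rewrite sqrtr_eq0 -ltNge.
  by field.
under eq_integral do rewrite sumE EFinM.
have mG : measurable_fun setT (fun v => (gauss_fun (F v) * f v)%:E).
  apply/measurable_EFinP; apply: measurable_funM.
    by rewrite (_ : (fun _ => _) = E)//; apply/funext => v; exact: FE.
  by apply: continuous_measurable_fun; exact: f_cont.
rewrite ge0_integralZl//.
- rewrite sqrtrM// mulrA [leRHS]EFinM lee_pmul2l// ?lte_fin ?mulr_gt0 ?sqrtr_gt0//.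
  rewrite -integralT_gauss.
  exact: (le_integral_increasing_substitution F_incr F_deriv f_cont f_ge0
            (@continuous_gauss_fun R) (@gauss_fun_ge0 R)).
- by move=> v _; rewrite lee_fin mulr_ge0 ?gauss_fun_ge0.
Qed.

Let half_sym : (\int[lebesgue_measure]_v (half 2^-1 v)%:E =
                \int[lebesgue_measure]_v (half (- 2^-1) v)%:E)%E.
Proof.
rewrite (ge0_integral_reflection 0); last 2 first.
- by apply/measurable_EFinP; exact: mhalf.
- by move=> v; rewrite lee_fin.
apply: eq_integral => v _; congr EFin; rewrite /half /E sub0r mulrN mulNr opprK.
by congr (_ * expR (- (_ * _))); ring.
Qed.

Let le_half : (\int[lebesgue_measure]_v (half 2^-1 v)%:E <=
               (Num.sqrt (2 * pi))%:E)%E.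
Proof.
have := le_sum_half.
under eq_integral do rewrite EFinD.
have mh c : measurable_fun [set: measurableTypeR R]
    (fun v : measurableTypeR R => (half c v)%:E).
  by apply/measurable_EFinP; exact: mhalf.
rewrite ge0_integralD//; last 2 first.
  by move=> v _; rewrite lee_fin.
  by move=> v _; rewrite lee_fin.
rewrite -half_sym; case: (\int[_]_v _)%E => [x| |].
- by rewrite -EFinD !lee_fin; lra.
- by rewrite addye.
- by rewrite !leNye.
Qed.

(** The factor [A + al * expR (- v)] is what remains of a linear combination of
    the [expR (u i)] once the coordinate of the eliminated vertex is expressed in
    terms of [v]. *)
Lemma le_inverse_gaussian_integral (A al : R) : 0 <= A -> 0 <= al ->
  (\int[lebesgue_measure]_v
     ((A + al * expR (- v)) * (Num.sqrt (a * expR v) *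
       expR (- (a / 2 * (expR v + expR (- v) - 2)))))%:E <=
   ((A + al) * Num.sqrt (2 * pi))%:E)%E.
Proof.
move=> A0 al0.
have splitE v : (A + al * expR (- v)) * (Num.sqrt (a * expR v) *
       expR (- (a / 2 * (expR v + expR (- v) - 2)))) =
    A * half 2^-1 v + al * half (- 2^-1) v.
  rewrite /half -/(E v).
  have -> : expR (- v) = expR (- 2^-1 * v) ^+ 2.
    by rewrite -expRM_natl; congr expR; field.
  have -> : Num.sqrt (a * expR v) = Num.sqrt a * expR (2^-1 * v).
    rewrite sqrtrM ?ltW//; congr (_ * _).
    by rewrite -sqr_half [v / 2]mulrC sqrtr_sqr ger0_norm ?expR_ge0.
  rewrite mulrDl; congr (_ + _).
  have h : expR (- 2^-1 * v) ^+ 2 * expR (2^-1 * v) = expR (- 2^-1 * v).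
    rewrite expr2 -mulrA mulNr [expR (- _) * expR _]mulrC.
    by rewrite expRxMexpNx_1 mulr1.
  by rewrite -[in RHS]h; ring.
under eq_integral do rewrite splitE EFinD (EFinM A) (EFinM al).
have mh c : measurable_fun [set: measurableTypeR R]
    (fun v : measurableTypeR R => (half c v)%:E).
  by apply/measurable_EFinP; exact: mhalf.
have hge0 c (v : measurableTypeR R) : [set: measurableTypeR R] v ->
  (0 <= (half c v)%:E)%E by rewrite lee_fin.
have cge0 k c (v : measurableTypeR R) : 0 <= k -> [set: measurableTypeR R] v ->
  (0 <= k%:E * (half c v)%:E)%E by move=> k0 _; rewrite mule_ge0 ?lee_fin.
have mch k c : measurable_fun [set: measurableTypeR R]
    (fun v : measurableTypeR R => (k%:E * (half c v)%:E)%E).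
  exact: measurable_funeM.
rewrite ge0_integralD//; [|by move=> v; apply: cge0..].
rewrite !ge0_integralZl//; [|by move=> v; apply: hge0..].
rewrite -half_sym mulrDl EFinD !EFinM.
by apply: leeD; apply: lee_pmul => //; rewrite ?lee_fin//; apply: integral_ge0 => v _; rewrite lee_fin.
Qed.

End inverse_gaussian.

(** * Elimination of a vertex *)

(** Gaussian elimination of the first row and column. *)
Lemma det_schur (K : fieldType) n (M : 'M[K]_(1 + n)) :
  M 0 0 != 0 ->
  \det M = M 0 0 * \det (\matrix_(i, k) (M (rshift 1 i) (rshift 1 k) -
             M (rshift 1 i) 0 * M 0 (rshift 1 k) / M 0 0)).
Proof.
move=> M00; set a := M 0 0; set S := (X in _ * \det X).
have -> : M = block_mx 1%:M 0 (a^-1 *: dlsubmx M) 1%:M *m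
              block_mx (ulsubmx M) (ursubmx M) 0 S.
  rewrite mulmx_block !mul1mx !mul0mx !addr0.
  rewrite -[LHS]submxK; congr block_mx; apply/matrixP => i j; rewrite !mxE.
    rewrite big_ord1 !mxE !ord1 lshift0 /a; field.
    exact: M00.
  by rewrite big_ord1 !mxE !lshift0 -/a; field.
rewrite det_mulmx det_lblock det_ublock !det1 !mul1r; congr (_ * _).
by rewrite [ulsubmx M]mx11_scalar det_scalar1 !mxE !lshift0.
Qed.

(** In this part the vertices are the integers [0, ..., n], the root is [n], and a
    field is a function [u] on the integers: with [u = nth 0 t] for a tuple [t] of
    size [n] the value at the root is automatically [0], and eliminating the first
    free vertex is a shift of the indices. *)
Section elimination.
Context (R : realType).
Implicit Types (n : nat) (c W : nat -> nat -> R) (u : nat -> R).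

Definition weight W u i j := W i j * expR (u j - u i).

Definition rooted_energy n W u : R :=
  \sum_(i < n.+1) \sum_(j < n.+1) W i j * (expR (u j - u i) - 1).

(** The Laplacian of the weights [c] without the row and column of the root; the
    diagonal weights [c i i] cancel. *)
Definition laplacian n c : 'M[R]_n :=
  \matrix_(i, k) ((i == k)%:R * \sum_(j < n.+1) c i j - c i k).

Definition rooted_density n W u : R :=
  expR (- (2^-1 * rooted_energy n W u)) * Num.sqrt (\det (laplacian n (weight W u))).

Lemma eq_laplacian n c c' : (forall i j, c i j = c' i j) ->
  laplacian n c = laplacian n c'.
Proof.
move=> cc'; apply/matrixP => i k; rewrite !mxE cc'.
by under eq_bigr do rewrite cc'.
Qed.

(** The Schur complement of a Laplacian is the Laplacian of the weights in which
    the walk through the eliminated vertex is short-circuited; here [b] is the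
    total weight out of this vertex. *)
Lemma det_laplacian_elim n c (b := \sum_(j < n.+1) c 0%N j.+1) : b != 0 ->
  \det (laplacian n.+1 c) =
  b * \det (laplacian n (fun i j => c i.+1 j.+1 + c i.+1 0%N * c 0%N j.+1 / b)).
Proof.
move=> b0.
have L00 : laplacian n.+1 c 0 0 = b.
  by rewrite mxE eqxx mul1r big_ord_recl/= addrAC subrr add0r.
rewrite (@det_schur _ n) L00//; congr (_ * \det _).
apply/matrixP => i k; rewrite !mxE.
have -> : (rshift 1 i == rshift 1 k :> 'I_(1 + n)) = (i == k).
  by apply/eqP/eqP => [/rshift_inj|->].
have -> : (rshift 1 i == 0 :> 'I_(1 + n)) = false by [].
have -> : (0 == rshift 1 k :> 'I_(1 + n)) = false by [].
rewrite !mul0r !sub0r /= add1n add1n.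
have -> : \sum_(j < n.+1) (c i.+1 j.+1 + c i.+1 0%N * c 0%N j.+1 / b) =
          \sum_(j < n.+2) c i.+1 j.
  rewrite big_split/= -mulr_suml -mulr_sumr -/b mulfK// [RHS]big_ord_recl addrC.
  by [].
by rewrite mulrNN; ring.
Qed.

(** A free vertex without outgoing weight is a zero row. *)
Lemma det_laplacian_eq0 n c : (forall j, (j < n.+1)%N -> c 0%N j.+1 = 0) ->
  \det (laplacian n.+1 c) = 0.
Proof.
move=> c0; rewrite (expand_det_row _ ord0) big1// => k _.
rewrite mxE; case: (unliftP ord0 k) => [j|] ->.
  rewrite (_ : (ord0 == _) = false)// mul0r sub0r c0 ?oppr0 ?mul0r//.
  exact: ltnW (ltn_ord j).
rewrite eqxx mul1r big_ord_recl/= big1 ?addr0 ?subrr ?mul0r// => j _.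
by rewrite c0.
Qed.

Definition scons (x : R) (u : nat -> R) i := if i is j.+1 then u j else x.

Definition head_weight n W : R := \sum_(j < n.+1) W 0%N j.+1.

(** The Schur complement of [W] when the total weight out of the vertex [0] is
    [head_weight n W * expR v]. *)
Definition elim_weights n W v i j :=
  W i.+1 j.+1 + W i.+1 0%N * W 0%N j.+1 * (expR (- v) / head_weight n W).

(** The value [u 0] for which the total weight out of [0], that is
    [\sum_j W 0 j * expR (u j - u 0)], is [head_weight n W * expR v]; for fixed [u] it
    is a reflection of [v], hence preserves Lebesgue measure. *)
Definition elim_value n W u v : R :=
  ln ((\sum_(j < n.+1) W 0%N j.+1 * expR (u j)) / head_weight n W) - v.

Section step.
Variables (n : nat) (W : nat -> nat -> R) (u : nat -> R) (v : R).
Hypothesis W_ge0 : forall i j, 0 <= W i j.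
Hypothesis W_sym : forall i j, W i j = W j i.
Let a := head_weight n W.
Hypothesis a_gt0 : 0 < a.
Let B := \sum_(j < n.+1) W 0%N j.+1 * expR (u j).
Let x := elim_value n W u v.
Let W' := elim_weights n W v.

Let B_gt0 : 0 < B.
Proof.
rewrite lt_neqAle sumr_ge0 ?andbT; last by move=> i _; rewrite mulr_ge0 ?expR_ge0.
apply/negP => /eqP/esym /psumr_eq0P B0.
move: a_gt0; rewrite /a /head_weight big1 ?ltxx// => j _; apply/eqP.
have := B0 (fun i _ => mulr_ge0 (W_ge0 _ _) (expR_ge0 _)) j isT.
by move/eqP; rewrite mulf_eq0 [expR _ == 0]gt_eqF ?expR_gt0// orbF.
Qed.

Let expRx : expR x = B * (expR (- v) / a).
Proof.
rewrite /x /elim_value expRD lnK; last by rewrite posrE divr_gt0.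
by rewrite -/B -/a mulrAC mulrA.
Qed.

Let expRNx : expR (- x) = a * expR v / B.
Proof. by rewrite expRN expRx expRN !invfM !invrK; ring. Qed.

Let weight0 j : weight W (scons x u) 0%N j.+1 = W 0%N j.+1 * expR (u j) * (a * expR v / B).
Proof. by rewrite /weight /= (expRD (u j)) expRNx mulrA. Qed.

Let weight0_sum : \sum_(j < n.+1) weight W (scons x u) 0%N j.+1 = a * expR v.
Proof.
under eq_bigr do rewrite weight0.
by rewrite -mulr_suml -/B; field; rewrite gt_eqF.
Qed.

Let weightE i j : weight W (scons x u) i.+1 j.+1 +
  weight W (scons x u) i.+1 0%N * weight W (scons x u) 0%N j.+1 / (a * expR v)
  = weight W' u i j.
Proof.
rewrite weight0 /weight /= /W' /elim_weights -/a mulrDl; congr (_ + _).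
rewrite (expRD x) expRx (expRD (u j)) !expRN; field.
by rewrite !gt_eqF ?expR_gt0.
Qed.

Lemma det_laplacian_elim_value :
  \det (laplacian n.+1 (weight W (scons x u))) =
  a * expR v * \det (laplacian n (weight W' u)).
Proof.
rewrite det_laplacian_elim weight0_sum; last by rewrite mulf_neq0 ?gt_eqF ?expR_gt0.
by congr (_ * \det _); apply: eq_laplacian => i j; exact: weightE.
Qed.

(** All the terms that contain the eliminated vertex collect into [W'], because
    [expR x] is itself a linear combination of the [expR (u j)], and into a
    function of [v] alone. *)
Lemma energy_elim_value : rooted_energy n.+1 W (scons x u) =
  rooted_energy n W' u + a * (expR v + expR (- v) - 2).
Proof.
pose energy0 := \sum_(i < n.+1) \sum_(j < n.+1)
  W i.+1 j.+1 * (expR (u j - u i) - 1).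
have -> : rooted_energy n.+1 W (scons x u) =
    \sum_(j < n.+1) W 0%N j.+1 * (expR (u j - x) - 1) +
    (\sum_(i < n.+1) W i.+1 0%N * (expR (x - u i) - 1) + energy0).
  rewrite /rooted_energy big_ord_recl [X in X + _]big_ord_recl /= subrr expR0 subrr.
  rewrite mulr0 add0r; congr (_ + _).
  by rewrite -big_split/=; apply: eq_bigr => i _; rewrite big_ord_recl.
have -> : \sum_(j < n.+1) W 0%N j.+1 * (expR (u j - x) - 1) = a * expR v - a.
  by under eq_bigr do rewrite mulrBr mulr1; rewrite sumrB -weight0_sum.
have -> : \sum_(i < n.+1) W i.+1 0%N * (expR (x - u i) - 1) =
   \sum_(i < n.+1) \sum_(j < n.+1)
     W i.+1 0%N * W 0%N j.+1 * (expR (- v) / a) * (expR (u j - u i) - 1)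
   + a * (expR (- v) - 1).
  have -> : a * (expR (- v) - 1) =
     \sum_(i < n.+1) \sum_(j < n.+1) W i.+1 0%N * W 0%N j.+1 * (expR (- v) / a)
     - \sum_(i < n.+1) W i.+1 0%N.
    rewrite (eq_bigr (fun i : 'I__ => W i.+1 0%N * expR (- v))); last first.
      move=> i _; rewrite -mulr_suml -mulr_sumr -/a -mulrA; congr (_ * _).
      by rewrite mulrC mulfVK// gt_eqF.
    have -> : \sum_(i < n.+1) W i.+1 0%N = a by apply: eq_bigr => i _; rewrite W_sym.
    rewrite -mulr_suml.
    have -> : \sum_(i < n.+1) W i.+1 0%N = a by apply: eq_bigr => i _; rewrite W_sym.
    by rewrite mulrBr mulr1.
  rewrite addrA -big_split /= -sumrB; apply: eq_bigr => i _.
  rewrite -big_split/= mulrBr mulr1; congr (_ - _).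
  rewrite (expRD x) expRx mulrAC /B -!mulrA mulr_suml mulr_sumr.
  by apply: eq_bigr => j _; rewrite expRD; ring.
have -> : rooted_energy n W' u = energy0 +
   \sum_(i < n.+1) \sum_(j < n.+1)
     W i.+1 0%N * W 0%N j.+1 * (expR (- v) / a) * (expR (u j - u i) - 1).
  rewrite -big_split; apply: eq_bigr => i _; rewrite -big_split.
  by apply: eq_bigr => j _; rewrite /W' /elim_weights mulrDl.
ring.
Qed.

Lemma density_elim_value : rooted_density n.+1 W (scons x u) =
  Num.sqrt (a * expR v) * expR (- (a / 2 * (expR v + expR (- v) - 2))) *
  rooted_density n W' u.
Proof.
rewrite /rooted_density energy_elim_value det_laplacian_elim_value.
rewrite sqrtrM; last by rewrite mulr_ge0 ?expR_ge0// ltW.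
rewrite (mulrDr 2^-1) opprD expRD [2^-1 * (a * _)]mulrA [2^-1 * a]mulrC; ring.
Qed.

Lemma sum_elim_value (al : nat -> R) :
  \sum_(i < n.+2) al i * expR (scons x u i) =
  \sum_(i < n.+1) (al i.+1 + al 0%N * (W 0%N i.+1 * (expR (- v) / a))) *
                  expR (u i).
Proof.
rewrite big_ord_recl /= expRx.
under [RHS]eq_bigr do rewrite mulrDl.
rewrite big_split /= addrC; congr (_ + _).
rewrite /B mulr_suml mulr_sumr; apply: eq_bigr => i _; ring.
Qed.

Lemma sum_elim_coef (al : nat -> R) :
  \sum_(i < n.+1) (al i.+1 + al 0%N * (W 0%N i.+1 * (expR (- v) / a))) =
  \sum_(i < n.+1) al i.+1 + al 0%N * expR (- v).
Proof.
rewrite big_split /=; congr (_ + _).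
rewrite -mulr_sumr -mulr_suml -/a; congr (_ * _).
by rewrite mulrC mulfVK// gt_eqF.
Qed.

End step.
End elimination.

(** * Normalization of the rooted model *)

Section normalization.
Context (R : realType).
Implicit Types (n : nat) (W : nat -> nat -> R).

Lemma measurable_sum_fin d (T : measurableType d) (I : finType)
    (h : I -> T -> R) :
  (forall i, measurable_fun setT (h i)) ->
  measurable_fun setT (fun x => \sum_i h i x).
Proof.
move=> mh; rewrite (_ : (fun _ => _) = fun x => \sum_(i <- enum I) h i x).
  exact: measurable_sum.
by apply/funext => x; rewrite big_enum.
Qed.

Lemma measurable_prod_fin d (T : measurableType d) (I : finType)
    (h : I -> T -> R) :
  (forall i, measurable_fun setT (h i)) ->
  measurable_fun setT (fun x => \prod_i h i x).
Proof.
move=> mh; rewrite (_ : (fun _ => _) = fun x => \prod_(i <- enum I) h i x).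
  by apply: measurable_prod => i _; exact: mh.
by apply/funext => x; rewrite big_enum.
Qed.

Lemma measurable_det d (T : measurableType d) n (M : T -> 'M[R]_n) :
  (forall i j, measurable_fun setT (fun x => M x i j)) ->
  measurable_fun setT (fun x => \det (M x)).
Proof.
move=> mM; apply: measurable_sum_fin => s; apply: measurable_funM => //.
by apply: measurable_prod_fin => i; exact: mM.
Qed.

Lemma measurable_nth n i : measurable_fun setT (fun t : n.-tuple R => t`_i).
Proof.
have [i_lt|i_ge] := ltnP i n.
  rewrite (_ : (fun _ => _) = fun t => tnth t (Ordinal i_lt)).
    exact: measurable_tnth.
  by apply/funext => t; rewrite (tnth_nth 0).
rewrite (_ : (fun _ => _) = cst 0)//; apply/funext => t.
by rewrite nth_default// size_tuple.
Qed.

Lemma measurable_expR_nth n i :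
  measurable_fun setT (fun t : n.-tuple R => expR t`_i).
Proof. by apply: measurableT_comp => //; exact: measurable_nth. Qed.

Let measurable_expR_grad n i j :
  measurable_fun setT (fun t : n.-tuple R => expR (t`_j - t`_i)).
Proof.
by apply: measurableT_comp => //; apply: measurable_funB; exact: measurable_nth.
Qed.

(** The density of the model against a positive linear combination of the
    [expR (u i)]: such combinations are stable under elimination, contrary to a
    single [expR (u i)]. *)
Definition weighted_density n W (al : nat -> R) (u : nat -> R) : R :=
  (\sum_(i < n.+1) al i * expR (u i)) * rooted_density n W u.

Lemma measurable_weighted_density n W al :
  measurable_fun setT (fun t : n.-tuple R => weighted_density n W al (nth 0 t)).
Proof.
have mexp := measurable_expR_grad.
apply: measurable_funM.
  apply: measurable_sum_fin => i; apply: measurable_funM => //.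
  exact: measurable_expR_nth.
apply: measurable_funM.
  apply: measurableT_comp => //; apply: measurableT_comp => //.
  apply: measurable_funM => //; apply: measurable_sum_fin => i.
  apply: measurable_sum_fin => j; apply: measurable_funM => //.
  by apply: measurable_funB => //; exact: mexp.
have msqrt : measurable_fun setT (@Num.sqrt R).
  by apply: continuous_measurable_fun; exact: sqrt_continuous.
apply: (measurableT_comp msqrt); apply: measurable_det => i j.
under eq_fun do rewrite mxE.
apply: measurable_funB; last by apply: measurable_funM => //; exact: mexp.
apply: measurable_funM => //; apply: measurable_sum_fin => k.
by apply: measurable_funM => //; exact: mexp.
Qed.

Lemma density_ge0 n W u : 0 <= rooted_density n W u.
Proof. by rewrite mulr_ge0 ?expR_ge0 ?sqrtr_ge0. Qed.

Lemma weighted_density_ge0 n W al u : (forall i, 0 <= al i) ->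
  0 <= weighted_density n W al u.
Proof.
move=> al0; rewrite mulr_ge0 ?density_ge0// sumr_ge0// => i _.
by rewrite mulr_ge0 ?expR_ge0.
Qed.

(** By induction on the number of free vertices, eliminating the first one.  The
    factor [Num.sqrt (2 * pi)] comes from the integral over [v] at each step; the
    inequality, and not an equality, accounts for disconnected conductances, whose
    density vanishes. *)
Lemma le_integral_weighted_density n W (al : nat -> R) :
  (forall i j, 0 <= W i j) -> (forall i j, W i j = W j i) ->
  (forall i, 0 <= al i) ->
  (\int[lebesgue_tuple R n]_t (weighted_density n W al (nth 0 t))%:E <=
   ((\sum_(i < n.+1) al i) * Num.sqrt (2 * pi) ^+ n)%:E)%E.
Proof.
elim: n W al => [|n IH] W al W0 Wsym al0.
  rewrite integral_dirac//; last first.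
    by apply/measurable_EFinP; exact: measurable_weighted_density.
  rewrite diracT mul1e lee_fin /weighted_density /rooted_density /rooted_energy.
  rewrite !big_ord1/= subrr expR0 subrr mulr0 mulr0 oppr0 expR0 det_mx00.
  by rewrite sqrtr1 !mulr1.
have mF := @measurable_weighted_density n.+1 W al.
have F0 u : 0 <= weighted_density n.+1 W al u by exact: weighted_density_ge0.
have mFE : measurable_fun setT
    (fun t : n.+1.-tuple R => (weighted_density n.+1 W al (nth 0 t))%:E).
  exact/measurable_EFinP.
pose a := head_weight n W.
have a0 : 0 <= a by exact: sumr_ge0.
have rhs0 : 0 <= (\sum_(i < n.+2) al i) * Num.sqrt (2 * pi) ^+ n.+1.
  by rewrite mulr_ge0 ?sumr_ge0// exprn_ge0// sqrtr_ge0.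
(* the vertex [0] is isolated, and the density vanishes *)
have [a_eq0|a_neq0] := eqVneq a 0.
  rewrite (eq_integral (cst 0%E)) ?integral0 ?lee_fin// => t _.
  rewrite /weighted_density /rooted_density det_laplacian_eq0 ?sqrtr0 ?mulr0//.
  move=> j jn; have /psumr_eq0P/(_ (Ordinal jn) isT)/= := a_eq0.
  by rewrite /weight => ->; rewrite ?mul0r.
have {a0 a_neq0} a0 : 0 < a by rewrite lt_neqAle eq_sym a_neq0.
rewrite ge0_integral_lebesgue_tupleS//; last first.
  by move=> t; rewrite lee_fin.
(* [J v] collects what depends on [v] alone; [W' v] and [al' v] are the data of the
   model on the remaining vertices *)
pose J v := Num.sqrt (a * expR v) *
            expR (- (a / 2 * (expR v + expR (- v) - 2))).
pose W' v := elim_weights n W v.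
pose al' v i := al i.+1 + al 0%N * (W 0%N i.+1 * (expR (- v) / a)).
pose x (t : n.-tuple R) := elim_value n W (nth 0 t).
have xE t v : weighted_density n.+1 W al (nth 0 (x t v :: t)) =
    J v * weighted_density n (W' v) (al' v) (nth 0 t).
  have -> : nth 0 (x t v :: t) = scons (x t v) (nth 0 t).
    by apply/funext => -[].
  by rewrite /weighted_density density_elim_value// sum_elim_value// mulrCA.
rewrite (eq_integral (fun t : n.-tuple R => \int[lebesgue_measure]_v
    (J v * weighted_density n (W' v) (al' v) (nth 0 t))%:E)%E); last first.
  move=> t _; rewrite (ge0_integral_reflection (x t 0)); last 2 first.
  - by apply: (measurableT_comp mFE) => /=; apply: measurable_cons.
  - by move=> v; rewrite lee_fin.
  apply: eq_integral => v _; have -> : (x t 0 - v)%R = x t v.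
    by rewrite /x /elim_value subr0.
  exact: (congr1 EFin (xE t v)).
have mlnB : measurable_fun setT (fun t : n.-tuple R => x t 0).
  apply: measurable_funB => //; apply: measurableT_comp => //.
  apply: measurable_funM => //; apply: measurable_sum_fin => j.
  by apply: measurable_funM => //; exact: measurable_expR_nth.
pose G (p : R * n.-tuple R) : \bar R :=
  (J p.1 * weighted_density n (W' p.1) (al' p.1) (nth 0 p.2))%:E.
have G0 p : (0 <= G p)%E by rewrite /G -xE lee_fin.
have mG : measurable_fun setT G.
  rewrite (_ : G = (fun t : n.+1.-tuple R =>
      (weighted_density n.+1 W al (nth 0 t))%:E) \o
      (fun p : R * n.-tuple R => [tuple of x p.2 p.1 :: p.2])); last first.
    by apply/funext => p; rewrite /G -xE.
  apply: (measurableT_comp mFE) => /=; apply: measurable_cons => //.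
  rewrite (_ : (fun _ => _) = fun p : R * n.-tuple R => x p.2 0 - p.1).
    by apply: measurable_funB => //; exact: (measurableT_comp mlnB).
  by apply/funext => p; rewrite /x /elim_value subr0.
rewrite -[leLHS]/(\int[lebesgue_tuple R n]_t
  \int[lebesgue_measure]_v (G (v, t)))%E -fubini_tonelli//.
have J0 v : 0 <= J v by rewrite mulr_ge0 ?sqrtr_ge0 ?expR_ge0.
have mJ : measurable_fun setT J.
  apply: measurable_funM.
    have msqrt : measurable_fun setT (@Num.sqrt R).
      by apply: continuous_measurable_fun; exact: sqrt_continuous.
    by apply: (measurableT_comp msqrt); exact: measurable_funM.
  apply: measurableT_comp => //; apply: measurableT_comp => //.
  apply: measurable_funM => //; apply: measurable_funB => //.
  by apply: measurable_funD => //; exact: measurableT_comp.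
pose A := \sum_(i < n.+1) al i.+1.
have A0 : 0 <= A by exact: sumr_ge0.
pose c := Num.sqrt (2 * pi : R) ^+ n.
have c0 : 0 <= c by rewrite exprn_ge0// sqrtr_ge0.
have mAJ : measurable_fun setT
    (fun v : measurableTypeR R => ((A + al 0%N * expR (- v)) * J v)%:E).
  apply/measurable_EFinP; apply: measurable_funM => //.
  apply: measurable_funD => //; apply: measurable_funM => //.
  exact: measurableT_comp.
have AJ0 v : (0 <= ((A + al 0%N * expR (- v)) * J v)%:E)%E.
  by rewrite lee_fin mulr_ge0 ?addr_ge0 ?mulr_ge0 ?expR_ge0.
apply: (@le_trans _ _ (\int[lebesgue_measure]_v
   (c%:E * ((A + al 0%N * expR (- v)) * J v)%:E)%E)%E).
  apply: ge0_le_integral => //.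
  - by move=> v _; apply: integral_ge0.
  - exact: (measurable_fun_fubini_tonelli_F G).
  - exact: measurable_funeM.
  move=> v _; rewrite /G /=.
  under eq_integral do rewrite EFinM.
  have ea0 : 0 <= expR (- v) / a by rewrite divr_ge0 ?expR_ge0// ltW.
  have W'0 i j : 0 <= W' v i j.
    by rewrite /W' /elim_weights -/a addr_ge0// mulr_ge0// mulr_ge0.
  have W'sym i j : W' v i j = W' v j i.
    rewrite /W' /elim_weights Wsym (Wsym i.+1 0%N) (Wsym 0%N j.+1).
    by rewrite [W 0%N i.+1 * _]mulrC.
  have al'0 i : 0 <= al' v i.
    by rewrite /al' -/a addr_ge0// mulr_ge0// mulr_ge0.
  have mw : measurable_fun setT (fun t : n.-tuple R =>
      (weighted_density n (W' v) (al' v) (nth 0 t))%:E).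
    by apply/measurable_EFinP; exact: measurable_weighted_density.
  rewrite (ge0_integralZl (lebesgue_tuple R n) measurableT mw) ?lee_fin//; last first.
    by move=> t _; rewrite lee_fin weighted_density_ge0.
  rewrite (EFinM _ (J v)) muleA [leRHS]muleC; apply: lee_wpmul2l.
    by rewrite lee_fin.
  apply: (le_trans (IH _ _ W'0 W'sym al'0)).
  by rewrite sum_elim_coef// -EFinM lee_fin mulrC.
rewrite ge0_integralZl ?lee_fin//.
have -> : \sum_(i < n.+2) al i = A + al 0%N by rewrite big_ord_recl addrC.
have -> : (A + al 0%N) * Num.sqrt (2 * pi) ^+ n.+1 =
    c * ((A + al 0%N) * Num.sqrt (2 * pi)) by rewrite exprSr /c; ring.
rewrite EFinM; apply: lee_wpmul2l; first by rewrite lee_fin.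
exact: le_inverse_gaussian_integral.
Qed.

End normalization.

(** * The matrix-tree theorem *)

(** A map [f] from the free vertices to all the vertices is a graph with one edge
    out of each free vertex; it is a spanning tree directed to the root [n] exactly
    when [n] is reached from everywhere. *)
Section functional_graph.
Variables (K : fieldType) (n : nat) (f : {ffun 'I_n -> 'I_n.+1}).

Definition fstep (k : nat) : nat := if insub k is Some i then f i else n.

Definition reaches_root : Prop := forall i : 'I_n, exists m, iter m fstep i = n.

Definition step_laplacian : 'M[K]_n :=
  \matrix_(i, k) ((i == k)%:R - (f i == k :> nat)%:R).

Lemma fstep_ord (i : 'I_n) : fstep i = f i.
Proof. by rewrite /fstep valK. Qed.

(** A permutation [s] different from the identity contributes to the Leibniz
    formula only if it agrees with [f] on the points that it moves; these points
    would then form cycles of [f], away from the root. *)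
Lemma det_step_laplacian1 : reaches_root -> \det step_laplacian = 1.
Proof.
move=> fr; rewrite /determinant (bigD1 (1%g : {perm (ordinal n)}))//= odd_perm1 expr0 mul1r.
rewrite big1 => [|i _]; last first.
  rewrite perm1 mxE eqxx; case: (eqVneq (f i : nat) i) => [fi|_]; last by rewrite subr0.
  have [m im] := fr i.
  have ii : iter m fstep i = i.
    by elim: (m) => //= m' ->; rewrite fstep_ord fi.
  by have := ltn_ord i; rewrite -ii im ltnn.
rewrite big1 ?addr0// => s s1.
have [i0 si0] : exists i0, s i0 != i0.
  apply/existsP; apply: contraR s1; rewrite negb_exists => /forallP h.
  by apply/eqP/permP => i; apply/eqP; rewrite perm1 -[_ == _]negbK.
apply/eqP; rewrite mulf_eq0; apply/orP; right; apply: contraT => /prodf_neq0 ne0.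
have fs i : s i != i -> f i = s i :> nat.
  move=> si; have := ne0 i isT; rewrite mxE [i == _]eq_sym (negbTE si) sub0r.
  by case: (eqVneq (f i : nat) (s i)) => // _; rewrite oppr_eq0 eqxx.
have [m im] := fr i0.
have [i1 [_ i1E]] : exists i1, s i1 != i1 /\ iter m fstep i0 = i1 :> nat.
  elim: (m) => [|m' [j [sj jE]]]; first by exists i0.
  exists (s j); split; first by rewrite (inj_eq perm_inj).
  by rewrite iterS jE fstep_ord fs.
by have := ltn_ord i1; rewrite -i1E im ltnn.
Qed.

(** The indicator function of the vertices from which the root is not reached is in
    the kernel. *)
Lemma det_step_laplacian0 : ~ reaches_root -> \det step_laplacian = 0.
Proof.
move=> /existsNP [i0 ni0].
pose x : 'rV[K]_n := \row_i (`[< exists m, iter m fstep i = n >] == false)%:R.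
apply/eqP; rewrite -det_tr; apply/det0P; exists x.
  apply/eqP => /matrixP/(_ 0 i0); rewrite !mxE.
  by rewrite asboolF// eqxx => /eqP; rewrite oner_eq0.
apply/matrixP => i k; rewrite !mxE.
under eq_bigr do rewrite !mxE mulrBr.
rewrite sumrB (bigD1 k)//= eqxx mulr1 big1 ?addr0; last first.
  by move=> j; rewrite eq_sym => /negbTE ->; rewrite mulr0.
have [fk|fk] := ltnP (f k) n.
  rewrite (bigD1 (Ordinal fk))//= eqxx mulr1 big1 ?addr0; last first.
    move=> j jk; rewrite [_ == _ :> nat]eq_sym (_ : (j == f k :> nat) = false) ?mulr0//.
    by apply/negbTE; rewrite -[f k : nat]/(val (Ordinal fk)) val_eqE.
  rewrite (_ : `[< _ >] = `[< exists m, iter m fstep (f k) = n >]) ?subrr//.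
  apply/asboolP/asboolP => -[m].
    case: m => [/= kn|m]; first by have := ltn_ord k; rewrite kn ltnn.
    by rewrite iterSr fstep_ord => h; exists m.
  by move=> h; exists m.+1; rewrite iterSr fstep_ord.
rewrite big1 => [|j _].
  rewrite asboolT ?subrr//; exists 1%N => /=; rewrite fstep_ord.
  by apply/eqP; rewrite eqn_leq fk -ltnS ltn_ord.
by rewrite gtn_eqF ?mulr0// (leq_trans (ltn_ord j)).
Qed.

End functional_graph.

(** The matrix-tree theorem.  The [i]-th row of the Laplacian is the sum over [j] of
    [c i j] times the [i]-th row of the Laplacian of any map that sends [i] to [j],
    and the determinant is linear in each row. *)
Lemma det_laplacian_sum (R : realType) n (c : nat -> nat -> R) :
  \det (laplacian n c) =
  \sum_(f : {ffun 'I_n -> 'I_n.+1} | `[< reaches_root f >])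
     \prod_(i < n) c i (f i).
Proof.
transitivity (\sum_(f : {ffun 'I_n -> 'I_n.+1})
   (\prod_(i < n) c i (f i)) * \det (step_laplacian R f)).
  rewrite /determinant.
  under [RHS]eq_bigr do rewrite mulr_sumr.
  rewrite exchange_big/=; apply: eq_bigr => s _.
  transitivity ((-1) ^+ s * \prod_(i < n) \sum_(j < n.+1)
     (c i j * ((i == s i)%:R - (j == s i :> nat)%:R))).
    congr (_ * _); apply: eq_bigr => i _; rewrite mxE.
    under [RHS]eq_bigr do rewrite mulrBr.
    rewrite sumrB -mulr_suml mulrC; congr (_ - _).
    rewrite (bigD1 (widen_ord (leqnSn n) (s i)))//= eqxx mulr1 big1 ?addr0// => j.
    by rewrite -val_eqE/= => /negbTE ->; rewrite mulr0.
  rewrite bigA_distr_bigA mulr_sumr; apply: eq_bigr => f _.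
  rewrite big_split/= mulrCA; congr (_ * (_ * _)).
  by apply: eq_bigr => i _; rewrite mxE.
rewrite [RHS]big_mkcond; apply: eq_bigr => f _; case: asboolP => fr.
  by rewrite det_step_laplacian1// mulr1.
by rewrite det_step_laplacian0// mulr0.
Qed.

(** * Spanning trees of the graph *)

Section vertex_enumeration.
Context (V : finType) (i0 : V).

Definition nb_free : nat := #|free_vertex i0|.

(** The free vertices in the order of the coordinates of [field_of], followed by the
    root: [field_of_vertex] turns a field into the sequence of its coordinates. *)
Definition vertex (k : nat) : V :=
  nth i0 [seq val x | x <- enum (free_vertex i0)] k.

Lemma size_free : size [seq val x | x <- enum (free_vertex i0)] = nb_free.
Proof. by rewrite size_map -cardE. Qed.

Lemma vertex_root k : (nb_free <= k)%N -> vertex k = i0.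
Proof. by move=> k_ge; rewrite /vertex nth_default// size_free. Qed.

Lemma vertex_free (k : 'I_nb_free) : vertex k = val (enum_val k).
Proof.
rewrite /vertex (nth_map (enum_val k)) -?cardE//; congr val.
exact/esym/enum_val_nth.
Qed.

Lemma vertex_neq_root (k : 'I_nb_free) : vertex k != i0.
Proof. by rewrite vertex_free; exact: (valP (enum_val k)). Qed.

Lemma vertex_lt_neq_root k : (k < nb_free)%N -> vertex k != i0.
Proof. by move=> kn; exact: (vertex_neq_root (Ordinal kn)). Qed.

Lemma vertex_inj k l : (k <= nb_free)%N -> (l <= nb_free)%N ->
  vertex k = vertex l -> k = l.
Proof.
have [kn kle|kn kle] := ltnP k nb_free; have [ln lle|ln lle] := ltnP l nb_free.
- have := @vertex_free (Ordinal kn); have := @vertex_free (Ordinal ln).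
  move=> /= -> -> /val_inj /enum_val_inj h.
  exact: (congr1 (@nat_of_ord _) h).
- by rewrite (vertex_root ln) => h; have := vertex_lt_neq_root kn; rewrite h eqxx.
- by rewrite (vertex_root kn) => h; have := vertex_lt_neq_root ln; rewrite -h eqxx.
- by move=> _; apply/eqP; rewrite eqn_leq (leq_trans kle) ?(leq_trans lle).
Qed.

Lemma vertex_ord_inj : injective (fun k : 'I_nb_free.+1 => vertex k).
Proof.
by move=> k l kl; apply/val_inj/(vertex_inj _ _ kl); rewrite -ltnS.
Qed.

Lemma vertex_surj (b : V) : exists k : 'I_nb_free.+1, vertex k = b.
Proof.
have [->|bi0] := eqVneq b i0; first by exists ord_max; rewrite vertex_root.
pose x : free_vertex i0 := Sub b bi0.
exists (widen_ord (leqnSn _) (enum_rank x)).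
by rewrite vertex_free enum_rankK.
Qed.

Lemma vertex_bij : bijective (fun k : 'I_nb_free.+1 => vertex k).
Proof.
apply: inj_card_bij; first exact: vertex_ord_inj.
pose g b := sval (cid (vertex_surj b)).
have gK : cancel g (fun k : 'I_nb_free.+1 => vertex k).
  by move=> b; rewrite /g; case: cid.
by rewrite (leq_card g)//; exact: can_inj gK.
Qed.

Lemma big_vertex (R : nmodType) (h : V -> R) :
  \sum_b h b = \sum_(k < nb_free.+1) h (vertex k).
Proof. by rewrite (reindex _ (onW_bij _ vertex_bij)). Qed.

Lemma card_vertex : #|V|.-1 = nb_free.
Proof. by rewrite -(bij_eq_card vertex_bij) card_ord. Qed.

Lemma field_of_vertex (R : realType) (t : nb_free.-tuple R) k :
  field_of (t : #|free_vertex i0|.-tuple R) (vertex k) = t`_k.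
Proof.
have [kn|kn] := ltnP k nb_free; last first.
  by rewrite vertex_root// field_of_root nth_default// size_tuple.
rewrite -[k]/(val (Ordinal kn)) vertex_free /field_of valK.
by rewrite enum_valK (tnth_nth 0).
Qed.

End vertex_enumeration.

Section tree_sum.
Context (R : realType) (V : finType) (e : rel V) (W : V -> V -> R) (i0 : V).
Hypothesis W_ge0 : forall i j, e i j -> 0 <= W i j.
Implicit Types (T : {set V * V}) (u : V -> R).

Local Notation n := (nb_free i0).
Local Notation vx := (vertex i0).

Definition pair_weight i j : R := if e i j then W i j else 0.

Let pair_weight_ge0 i j : 0 <= pair_weight i j.
Proof. by rewrite /pair_weight; case: ifP => // /W_ge0. Qed.

Let tree_walk T i : T \in spanning_trees e i0 ->
  exists! w : seq V, path (fun a b => (a, b) \in T) i w /\ last i w = i0.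
Proof. by rewrite inE => /andP[_ /asboolP]. Qed.

Let tree_root T b : T \in spanning_trees e i0 -> (i0, b) \notin T.
Proof.
move=> TT; apply/negP => i0b.
have [w [[pw lw] _]] := tree_walk b TT.
have [w' [_ uw]] := tree_walk i0 TT.
have := uw [::] (conj isT erefl).
by rewrite (uw (b :: w)) //=; split=> //; apply/andP.
Qed.

Let tree_edge_uniq T a b b' : T \in spanning_trees e i0 ->
  (a, b) \in T -> (a, b') \in T -> b = b'.
Proof.
move=> TT ab ab'.
have [w [[pw lw] _]] := tree_walk b TT.
have [w' [[pw' lw'] _]] := tree_walk b' TT.
have [w'' [_ uw]] := tree_walk a TT.
have h1 := uw (b :: w); have h2 := uw (b' :: w').
have : b :: w = b' :: w' by rewrite -h1 ?h2//= ?ab ?ab'.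
by case.
Qed.

Let tree_edge_ex T a : T \in spanning_trees e i0 -> a != i0 ->
  exists b, (a, b) \in T.
Proof.
move=> TT ai0; have [[|b w] [[/= pw lw] _]] := tree_walk a TT.
  by move: ai0; rewrite lw eqxx.
by exists b; case/andP: pw.
Qed.

Definition tree_parent T : {ffun 'I_n -> 'I_n.+1} :=
  [ffun i : 'I_n => odflt ord_max [pick j : 'I_n.+1 | (vx i, vx j) \in T]].

Let tree_parentP T (i : 'I_n) : T \in spanning_trees e i0 ->
  (vx i, vx (tree_parent T i)) \in T.
Proof.
move=> TT; rewrite ffunE; case: pickP => //= nj.
have [b ib] := tree_edge_ex TT (vertex_neq_root i).
have [j jb] := vertex_surj i0 b.
by have := nj j; rewrite jb ib.
Qed.

Let tree_parentE T : T \in spanning_trees e i0 ->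
  T = [set (vx i, vx (tree_parent T i)) | i : 'I_n]%SET.
Proof.
move=> TT; apply/setP => -[a b]; apply/idP/imsetP => [ab|[i _ [-> ->]]].
  have [k ka] := vertex_surj i0 a.
  have kn : (k < n)%N.
    rewrite ltn_neqAle -ltnS ltn_ord andbT; apply/eqP => kn.
    by have := tree_root b TT; rewrite -(@vertex_root _ i0 n)// -kn ka ab.
  exists (Ordinal kn) => //=; rewrite ka; congr pair.
  apply: (tree_edge_uniq TT ab).
  by have := tree_parentP (Ordinal kn) TT; rewrite /= ka.
exact: tree_parentP.
Qed.

(** Following parents is following the walk to the root. *)
Let tree_parent_reaches T : T \in spanning_trees e i0 ->
  reaches_root (tree_parent T).
Proof.
move=> TT.
have main w (k : 'I_n.+1) : path (fun a b => (a, b) \in T) (vx k) w ->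
    last (vx k) w = i0 -> iter (size w) (fstep (tree_parent T)) k = n.
  elim: w k => [|b w IH] k /=.
    move=> _ ki0; have -> // : k = ord_max.
    by apply: (@vertex_ord_inj _ i0); rewrite /= [RHS]vertex_root.
  move=> /andP[kb pw] lw; rewrite -iterS iterSr.
  have kn : (k < n)%N.
    rewrite ltn_neqAle -ltnS ltn_ord andbT; apply/eqP => kn.
    by have := tree_root b TT; rewrite -(@vertex_root _ i0 n)// -kn kb.
  have [j jb] := vertex_surj i0 b.
  rewrite -[k : nat]/(val (Ordinal kn)) fstep_ord.
  have -> : tree_parent T (Ordinal kn) = j.
    apply: (@vertex_ord_inj _ i0); rewrite /= jb.
    exact/esym/(tree_edge_uniq TT kb)/(tree_parentP (Ordinal kn) TT).
  by apply: IH; rewrite jb.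
move=> i; have [w [[pw lw] _]] := tree_walk (vx i) TT.
exists (size w).
exact: (main w (widen_ord (leqnSn n) i)).
Qed.

(** Each spanning tree is the graph of its parent map, so that its weight is a term
    of the matrix-tree expansion, and all the terms are nonnegative. *)
Lemma tree_sum_le_det u :
  tree_sum e W i0 u <= \det (laplacian n
    (weight (fun i j => pair_weight (vx i) (vx j)) (fun i => u (vx i)))).
Proof.
rewrite det_laplacian_sum; set c := weight _ _.
have c0 i j : 0 <= c i j by rewrite mulr_ge0 ?expR_ge0.
have prodE T : T \in spanning_trees e i0 ->
    \prod_(p in T) (W p.1 p.2 * expR (u p.2 - u p.1)) =
    \prod_(i < n) c i (tree_parent T i).
  move=> TT; have Te : T \subset directed_edges e by move: TT; rewrite inE => /andP[].
  rewrite [in LHS](tree_parentE TT) big_imset/=; last first.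
    by move=> i j _ _ [ij _]; apply/val_inj/(vertex_inj _ _ ij); exact: ltnW.
  apply: eq_bigr => i _; rewrite /c /weight /pair_weight.
  by have := fintype.subsetP Te _ (tree_parentP i TT); rewrite inE /= => ->.
rewrite /tree_sum (eq_bigr _ prodE).
rewrite -(@big_imset _ _ _ _ _ tree_parent (mem (spanning_trees e i0))
  (fun f : {ffun 'I_n -> 'I_n.+1} => \prod_(i < n) c i (f i)))/=; last first.
  move=> T T' TT TT' tt; rewrite (tree_parentE TT) (tree_parentE TT').
  by apply: eq_imset => i; rewrite tt.
rewrite big_mkcond [leRHS]big_mkcond; apply: ler_sum => f _.
case: ifPn => [/imsetP[T TT ->]|_].
  by rewrite asboolT//; exact: tree_parent_reaches.
by case: ifP => // _; exact: prodr_ge0.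
Qed.

End tree_sum.

(** * Normalization of the mixing field *)

Section mixing_normalization.
Context (R : realType) (V : finType) (e : rel V) (W : V -> V -> R) (i0 : V).
Hypothesis W_ge0 : forall i j, e i j -> 0 <= W i j.
Hypothesis W_sym : forall i j, e i j -> W i j = W j i.
Hypothesis e_sym : symmetric e.

Local Notation n := (nb_free i0).
Local Notation vx := (vertex i0).
Let Wn i j := pair_weight e W (vx i) (vx j).

Lemma mixing_density_le (u : V -> R) :
  mixing_density e W i0 u <=
  (2 * pi) `^ (- (n%:R / 2)) * rooted_density n Wn (fun i => u (vx i)).
Proof.
rewrite /mixing_density (card_vertex i0) -mulrA ler_wpM2l ?powR_ge0//.
rewrite /rooted_density /rooted_energy.
have -> : \sum_(i < n.+1) \sum_(j < n.+1)
     Wn i j * (expR (u (vx j) - u (vx i)) - 1) =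
   \sum_(p in directed_edges e) W p.1 p.2 * (expR (u p.2 - u p.1) - 1).
  rewrite [RHS]big_mkcond/= [RHS](eq_bigr (fun p : V * V =>
    pair_weight e W p.1 p.2 * (expR (u p.2 - u p.1) - 1))); last first.
    by move=> p _; rewrite inE /pair_weight; case: ifP; rewrite ?mul0r.
  rewrite -(pair_bigA _ (fun a b => pair_weight e W a b * (expR (u b - u a) - 1))).
  rewrite /= [RHS](big_vertex i0); apply: eq_bigr => i _.
  by rewrite [RHS](big_vertex i0).
rewrite ler_wpM2l ?expR_ge0// ler_wsqrtr//.
exact: tree_sum_le_det.
Qed.

Lemma powR_sqrt2pi : (2 * pi : R) `^ (- (n%:R / 2)) * Num.sqrt (2 * pi) ^+ n = 1.
Proof.
have p0 : 0 < 2 * pi :> R by rewrite mulr_gt0// pi_gt0.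
rewrite powRN -(powR_mulrn _ (sqrtr_ge0 _)) -powR12_sqrt ?ltW// -powRrM.
by rewrite mulrC [2^-1 * _]mulrC mulfV// gt_eqF// powR_gt0.
Qed.

(** The case where [y] is the root is the total mass, since [field_of t i0 = 0]. *)
Lemma le_integral_mixing_density (y : V) :
  (\int[lebesgue_tuple R n]_t (expR (field_of (i0 := i0) t y) *
     mixing_density e W i0 (field_of t))%:E <= 1)%E.
Proof.
have [k ky] := vertex_surj i0 y.
pose al (i : nat) : R := (i == k)%:R.
have p2 : 0 <= (2 * pi : R) `^ (- (n%:R / 2)) by exact: powR_ge0.
have mw := @measurable_weighted_density R n Wn al.
have w0 (u : nat -> R) : 0 <= weighted_density n Wn al u.
  by apply: weighted_density_ge0 => i; rewrite /al ler0n.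
apply: (@le_trans _ _ (\int[lebesgue_tuple R n]_t
   (((2 * pi) `^ (- (n%:R / 2)))%:E *
   (weighted_density n Wn al (nth 0 t))%:E))%E).
  apply: ge0_le_integral => //.
  - by move=> t _; rewrite lee_fin mulr_ge0 ?expR_ge0 ?mixing_density_ge0.
  - apply/measurable_EFinP; apply: measurable_funM.
      by apply: measurableT_comp => //; exact: measurable_field_of.
    exact: measurable_mixing_density.
  - by apply: measurable_funeM; exact/measurable_EFinP.
  move=> t _; rewrite -EFinM lee_fin.
  have uE : (fun i => field_of (i0 := i0) t (vx i)) = nth 0 t.
    by apply/funext => i; exact: field_of_vertex.
  have := mixing_density_le (field_of t); rewrite uE => /(ler_wpM2l (expR_ge0 _)).
  move=> /(_ (field_of t y)) /le_trans; apply.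
  rewrite /weighted_density mulrCA ler_wpM2l// ler_wpM2r ?density_ge0//.
  rewrite (bigD1 k)//= big1 ?addr0; last first.
    by move=> i; rewrite -val_eqE /al/= => /negbTE ->; rewrite mul0r.
  by rewrite /al eqxx mul1r -ky field_of_vertex.
have mwE : measurable_fun setT
    (fun t : n.-tuple R => (weighted_density n Wn al (nth 0 t))%:E).
  exact/measurable_EFinP.
rewrite ge0_integralZl ?lee_fin//; last by move=> t _; rewrite lee_fin.
have Wn0 i j : 0 <= Wn i j by rewrite /Wn /pair_weight; case: ifP => // /W_ge0.
have Wns i j : Wn i j = Wn j i.
  by rewrite /Wn /pair_weight e_sym; case: ifP => // /W_sym.
have al0 i : 0 <= al i by rewrite /al ler0n.
apply: (le_trans (lee_wpmul2l _ (le_integral_weighted_density n Wn0 Wns al0))).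
  by rewrite lee_fin.
rewrite -EFinM lee_fin (bigD1 k)//= big1 ?addr0; last first.
  by move=> i; rewrite -val_eqE /al/= => /negbTE ->.
by rewrite /al eqxx mul1r powR_sqrt2pi.
Qed.

End mixing_normalization.

(** * Deformation of the mixing density *)

Section convexity.
Context (R : realType).

(** Multiply by [1 - z] and use [1 - z <= expR (- z)]. *)
Lemma expR_le_quadratic (z : R) : z <= 1 / 2 -> expR z <= 1 + z + 2 * z ^+ 2.
Proof.
move=> z_le; have z1 : 0 < 1 - z by lra.
have : (1 - z) * expR z <= 1.
  rewrite -[leRHS](expRxMexpNx_1 z) mulrC ler_wpM2l ?expR_ge0//.
  exact: expR_ge1Dx.
rewrite mulrC -ler_pdivlMr// div1r => /le_trans; apply.
rewrite -div1r ler_pdivrMr//.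
have : 0 <= z ^+ 2 * (1 - 2 * z) by rewrite mulr_ge0 ?sqr_ge0//; lra.
rewrite !expr2; nra.
Qed.

(** Average the tangent inequality at the barycentre [m]. *)
Lemma expR_convex (s a b : R) : 0 <= s <= 1 ->
  expR (s * a + (1 - s) * b) <= s * expR a + (1 - s) * expR b.
Proof.
move=> /andP[s0 s1]; set m := s * a + _.
have tangent x : expR m * (1 + (x - m)) <= expR x.
  rewrite -[X in _ <= expR X](subrK m) [leRHS]expRD mulrC ler_wpM2r ?expR_ge0//.
  exact: expR_ge1Dx.
have ta := ler_wpM2l s0 (tangent a).
have tb := ler_wpM2l (_ : 0 <= 1 - s) (tangent b).
have {}tb := tb ltac:(lra).
apply: le_trans (lerD ta tb).
by rewrite le_eqVlt; apply/orP; left; apply/eqP; rewrite /m; ring.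
Qed.

(** Log-convexity of a sum of exponentials: it is the convexity of [expR] applied to
    each term, once the two sums are normalized by [expR x] and [expR y]. *)
Lemma sum_expR_log_convex (I : finType) (P : pred I) (w a b : I -> R)
    (s x y : R) :
  0 <= s <= 1 -> (forall i, P i -> 0 <= w i) ->
  \sum_(i | P i) w i * expR (a i) = expR x ->
  \sum_(i | P i) w i * expR (b i) = expR y ->
  \sum_(i | P i) w i * expR (s * a i + (1 - s) * b i) <=
  expR (s * x + (1 - s) * y).
Proof.
move=> s01 w0 ax bY; set m := s * x + _.
apply: (@le_trans _ _ (\sum_(i | P i) expR m *
   (s * expR (- x) * (w i * expR (a i)) +
    (1 - s) * expR (- y) * (w i * expR (b i))))).
  apply: ler_sum => i Pi.
  have -> : s * a i + (1 - s) * b i =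
            m + (s * (a i - x) + (1 - s) * (b i - y)) by rewrite /m; ring.
  rewrite expRD mulrCA ler_wpM2l ?expR_ge0//.
  apply: (le_trans (ler_wpM2l (w0 i Pi) (expR_convex _ _ s01))).
  by rewrite le_eqVlt !expRD; apply/orP; left; apply/eqP; ring.
rewrite -mulr_sumr big_split/= -!mulr_sumr ax bY -!mulrA.
have expK (z : R) : expR (- z) * expR z = 1 by rewrite mulrC expRxMexpNx_1.
rewrite (expK x) (expK y) !mulr1.
by rewrite le_eqVlt; apply/orP; left; apply/eqP; ring.
Qed.

(** The relation [s = (1 - s) * q] cancels the term of first order in [d]; the
    second-order term is absorbed by [w'], smaller than [w] by a factor
    [1 + 2 * q * d ^+ 2]. *)
Lemma deformed_edge_le (s q w w' x d : R) : 0 < s < 1 -> q = s / (1 - s) ->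
  0 <= w' -> w' * (1 + 2 * q * d ^+ 2) = w ->
  d <= 1 / 2 -> - (q * d) <= 1 / 2 ->
  s * (w' * (expR (x + d) - 1)) + (1 - s) * (w' * (expR (x - q * d) - 1)) <=
  w * (expR x - 1) + 2 * q * d ^+ 2 * w.
Proof.
move=> /andP[s0 s1] qE w'0 <- d_le qd_le.
have t0 : 0 < 1 - s by lra.
have q0 : 0 <= q by rewrite qE divr_ge0 ?ltW.
set r := 2 * q * d ^+ 2.
have r0 : 0 <= r by apply: mulr_ge0; [exact: mulr_ge0 | exact: sqr_ge0].
have mix : s * expR d + (1 - s) * expR (- (q * d)) <= 1 + r.
  apply: (le_trans (lerD (ler_wpM2l (ltW s0) (expR_le_quadratic d_le))
                         (ler_wpM2l (ltW t0) (expR_le_quadratic qd_le)))).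
  rewrite le_eqVlt; apply/orP; left; apply/eqP; rewrite /r qE; field.
  by rewrite gt_eqF.
rewrite !expRD.
have := ler_wpM2l (mulr_ge0 w'0 (expR_ge0 x)) mix.
have : 0 <= w' * r * r by apply: mulr_ge0 => //; exact: mulr_ge0.
lra.
Qed.

End convexity.

Section deformation.
Context (R : realType) (V : finType) (e : rel V) (W : V -> V -> R) (i0 : V).
Hypothesis W_ge0 : forall i j, e i j -> 0 <= W i j.
Variables (s q : R) (h : V -> R).
Hypothesis s01 : 0 < s < 1.
Hypothesis qE : q = s / (1 - s).
Hypothesis h_le : forall i j, e i j ->
  h j - h i <= 1 / 2 /\ - (q * (h j - h i)) <= 1 / 2.

Let r i j := 2 * q * (h j - h i) ^+ 2.

(** The conductances that absorb the second-order cost of the deformation [h]. *)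
Definition damped_conductance i j := W i j / (1 + 2 * q * (h j - h i) ^+ 2).
Local Notation W' := damped_conductance.

Let q_ge0 : 0 <= q.
Proof. by case/andP: s01 => s0 s1; rewrite qE divr_ge0 ?ltW// subr_gt0. Qed.

Let r_ge0 i j : 0 <= r i j.
Proof. by apply: mulr_ge0; [exact: mulr_ge0 | exact: sqr_ge0]. Qed.

Let W'_ge0 i j : e i j -> 0 <= W' i j.
Proof. by move=> /W_ge0 w0; rewrite divr_ge0// addr_ge0//; exact: r_ge0. Qed.

Let hp (u : V -> R) : V -> R := fun b => u b + h b.
Let hm (u : V -> R) : V -> R := fun b => u b - q * h b.
Let en (w : V -> V -> R) (u : V -> R) :=
  \sum_(p in directed_edges e) w p.1 p.2 * (expR (u p.2 - u p.1) - 1).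
Let rsum := \sum_(p in directed_edges e) r p.1 p.2.
Let rWsum := \sum_(p in directed_edges e) r p.1 p.2 * W p.1 p.2.

Let energy_le (u : V -> R) :
  s * en W' (hp u) + (1 - s) * en W' (hm u) <= en W u + rWsum.
Proof.
rewrite /en !mulr_sumr -!big_split/=; apply: ler_sum => -[i j].
rewrite inE /= => eij; have [h1 h2] := h_le eij.
have w'E : W' i j * (1 + 2 * q * (h j - h i) ^+ 2) = W i j.
  by rewrite /W' mulfVK// gt_eqF// ltr_wpDr//; exact: r_ge0.
have := deformed_edge_le (u j - u i) s01 qE (W'_ge0 eij) w'E h1 h2.
rewrite /hp /hm /r.
have -> : u j + h j - (u i + h i) = u j - u i + (h j - h i) by ring.
by have -> : u j - q * h j - (u i - q * h i) = u j - u i - q * (h j - h i) by ring.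
Qed.

Let tree_weight (w : V -> V -> R) (T : {set V * V}) := \prod_(p in T) w p.1 p.2.
Let grad (u : V -> R) (T : {set V * V}) := \sum_(p in T) (u p.2 - u p.1).

Let tree_sumE w u : tree_sum e w i0 u =
  \sum_(T in spanning_trees e i0) tree_weight w T * expR (grad u T).
Proof.
apply: eq_bigr => T _; rewrite big_split/=; congr (_ * _).
by rewrite expR_sum.
Qed.

Let tree_edges T p : T \in spanning_trees e i0 -> p \in T -> e p.1 p.2.
Proof.
rewrite inE => /andP[/fintype.subsetP Te _] /Te; rewrite inE; exact.
Qed.

Let tree_weight_ge0 T : T \in spanning_trees e i0 -> 0 <= tree_weight W' T.
Proof.
by move=> TT; apply: prodr_ge0 => p pT; apply: W'_ge0; exact: tree_edges pT.
Qed.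

(** A tree uses each directed edge at most once. *)
Let tree_weight_le T : T \in spanning_trees e i0 ->
  tree_weight W T <= expR rsum * tree_weight W' T.
Proof.
move=> TT; have -> : tree_weight W T =
    (\prod_(p in T) (1 + r p.1 p.2)) * tree_weight W' T.
  rewrite -big_split/=; apply: eq_bigr => p _.
  by rewrite /W' mulrC mulfVK// gt_eqF// ltr_wpDr//; exact: r_ge0.
rewrite ler_wpM2r ?tree_weight_ge0//.
apply: (@le_trans _ _ (expR (\sum_(p in T) r p.1 p.2))).
  rewrite expR_sum; apply: ler_prod => p _.
  by rewrite addr_ge0 ?r_ge0//= expR_ge1Dx.
rewrite ler_expR /rsum big_mkcond [leRHS]big_mkcond; apply: ler_sum => p _.
case: ifP => pT; last by case: ifP => // _; exact: r_ge0.
by rewrite inE (tree_edges TT pT).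
Qed.

Let tree_sum_le u : tree_sum e W i0 u <= expR rsum *
  \sum_(T in spanning_trees e i0) tree_weight W' T *
     expR (s * grad (hp u) T + (1 - s) * grad (hm u) T).
Proof.
rewrite tree_sumE mulr_sumr; apply: ler_sum => T TT; rewrite mulrA.
apply: ler_pM => //.
- by apply: prodr_ge0 => p pT; apply: W_ge0; exact: tree_edges pT.
- exact: tree_weight_le.
rewrite le_eqVlt; apply/orP; left; apply/eqP; congr expR.
rewrite /grad !mulr_sumr -big_split/=; apply: eq_bigr => p _.
rewrite /hp /hm qE; field; rewrite gt_eqF// subr_gt0.
by case/andP: s01.
Qed.

Let expR_half (z : R) : Num.sqrt (expR z) = expR (z / 2).
Proof.
have -> : expR z = expR (z / 2) ^+ 2 by rewrite -expRM_natl; congr expR; field.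
by rewrite sqrtr_sqr ger0_norm ?expR_ge0.
Qed.

Let mixing_densityE w u : mixing_density e w i0 u =
  (2 * pi) `^ (- ((#|V|.-1)%:R / 2)) *
  (expR (- (2^-1 * en w u)) * Num.sqrt (tree_sum e w i0 u)).
Proof. by rewrite /mixing_density -mulrA. Qed.

(** The two fields on the right have [u] as barycentre with weights [s] and [1 - s];
    the logarithm of the tree sum is convex, and the convexity of [expR] turns the
    geometric mean of the two densities into the arithmetic one. *)
Lemma mixing_density_deformation_le (u : V -> R) y :
  expR (s * u y) * mixing_density e W i0 u <=
  expR ((rsum + rWsum) / 2 - s * h y) *
   (s * (expR (u y + h y) * mixing_density e W' i0 (fun b => u b + h b)) +
    (1 - s) * mixing_density e W' i0 (fun b => u b - q * h b)).
Proof.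
have [s0 s1] := andP s01; have t0 : 0 <= 1 - s by rewrite subr_ge0 ltW.
rewrite -/(hp u) -/(hm u).
have p0 w v : 0 <= mixing_density e w i0 v by exact: mixing_density_ge0.
(* without spanning trees the density vanishes, and the logarithms below do not
   make sense *)
have [/psumr_eq0P tw0|tw_neq0] :=
    eqVneq (\sum_(T in spanning_trees e i0) tree_weight W' T) 0.
  have D0 : tree_sum e W i0 u <= 0.
    apply: (le_trans (tree_sum_le u)); rewrite big1 ?mulr0// => T TT.
    by rewrite tw0 ?mul0r// => T' /tree_weight_ge0.
  rewrite {1}/mixing_density (ler0_sqrtr D0) !mulr0 mulr_ge0 ?expR_ge0//.
  apply: addr_ge0; last by rewrite mulr_ge0 ?p0.
  by rewrite mulr_ge0 ?(ltW s0)// mulr_ge0 ?expR_ge0 ?p0.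
have tree_gt0 v : 0 < tree_sum e W' i0 v.
  rewrite tree_sumE lt_neqAle sumr_ge0 ?andbT; last first.
    by move=> T TT; rewrite mulr_ge0 ?expR_ge0 ?tree_weight_ge0.
  apply: contra tw_neq0 => /eqP/esym/psumr_eq0P h0.
  apply/eqP/big1 => T TT; apply/eqP.
  have := h0 (fun T TT => mulr_ge0 (tree_weight_ge0 TT) (expR_ge0 _)) T TT.
  by move/eqP; rewrite mulf_eq0 [expR _ == 0]gt_eqF ?expR_gt0// orbF.
pose lX := ln (tree_sum e W' i0 (hp u)); pose lY := ln (tree_sum e W' i0 (hm u)).
have XE : expR lX = tree_sum e W' i0 (hp u) by rewrite lnK// posrE.
have YE : expR lY = tree_sum e W' i0 (hm u) by rewrite lnK// posrE.
have s01' : 0 <= s <= 1 by rewrite !ltW.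
have D_le : tree_sum e W i0 u <= expR (rsum + (s * lX + (1 - s) * lY)).
  apply: (le_trans (tree_sum_le u)); rewrite expRD ler_wpM2l ?expR_ge0//.
  apply: (sum_expR_log_convex s01' tree_weight_ge0).
    by rewrite XE tree_sumE.
  by rewrite YE tree_sumE.
have {}D_le := ler_wsqrtr D_le; rewrite expR_half in D_le.
have XE' : Num.sqrt (tree_sum e W' i0 (hp u)) = expR (lX / 2).
  exact: etrans (congr1 Num.sqrt (esym XE)) (expR_half lX).
have YE' : Num.sqrt (tree_sum e W' i0 (hm u)) = expR (lY / 2).
  exact: etrans (congr1 Num.sqrt (esym YE)) (expR_half lY).
rewrite !mixing_densityE XE' YE'.
set c0 := (2 * pi) `^ _; have c0_ge0 : 0 <= c0 by exact: powR_ge0.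
have := energy_le u.
move: (en W u) (en W' (hp u)) (en W' (hm u)) => E Ep Em E_le.
pose A := u y + h y - 2^-1 * Ep + lX / 2.
pose B := - (2^-1 * Em) + lY / 2.
have -> : expR (u y + h y) * (c0 * (expR (- (2^-1 * Ep)) * expR (lX / 2))) =
    c0 * expR A by rewrite mulrCA -!expRD /A addrA.
rewrite -expRD -/B mulrCA [(1 - s) * _]mulrCA [s * (c0 * _)]mulrCA -mulrDr.
rewrite [leRHS]mulrCA ler_wpM2l//.
apply: (@le_trans _ _ (expR (s * u y) * (expR (- (2^-1 * E)) *
   expR ((rsum + (s * lX + (1 - s) * lY)) / 2)))).
  by do 2![apply: ler_wpM2l; first exact: expR_ge0].
apply: le_trans (ler_wpM2l (expR_ge0 _) (expR_convex A B s01')).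
rewrite -!expRD ler_expR /A /B.
clearbody lX lY rsum rWsum; move: (u y) (h y) => uy hy; lra.
Qed.

End deformation.

(** * The deformation bound *)

Section deformation_bound.
Context (R : realType) (V : finType) (e : rel V) (W : V -> V -> R) (i0 : V).
Hypothesis W_ge0 : forall i j, e i j -> 0 <= W i j.
Hypothesis W_sym : forall i j, e i j -> W i j = W j i.
Hypothesis e_sym : symmetric e.
Variables (s : R) (h : V -> R).
Hypothesis s01 : 0 < s < 1.
Let q := s / (1 - s).
Hypothesis h_root : h i0 = 0.
Hypothesis h_le : forall i j, e i j ->
  h j - h i <= 1 / 2 /\ - (q * (h j - h i)) <= 1 / 2.

Local Notation n := (nb_free i0).

Let shift (c : R) : n.-tuple R := [tuple c * h (vertex i0 i) | i < n].

Let field_of_shift c (t : n.-tuple R) b :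
  field_of (i0 := i0) (tuple_add t (shift c)) b =
  field_of (i0 := i0) t b + c * h b.
Proof.
have [k <-] := vertex_surj i0 b; rewrite !field_of_vertex.
have [kn|kn] := ltnP k n.
  by rewrite -[k : nat]/(val (Ordinal kn)) -!tnth_nth !tnth_mktuple.
by rewrite !nth_default ?size_tuple// vertex_root// h_root mulr0 addr0.
Qed.

Let W' := damped_conductance W q h.

Let W'_ge0 i j : e i j -> 0 <= W' i j.
Proof.
move=> /W_ge0 w0; case/andP: s01 => s0 s1.
rewrite divr_ge0// addr_ge0// mulr_ge0 ?sqr_ge0// mulr_ge0// divr_ge0 ?ltW//.
by rewrite subr_gt0.
Qed.

Let W'_sym i j : e i j -> W' i j = W' j i.
Proof.
by move=> /W_sym wE; rewrite /W' /damped_conductance wE -[h j - h i]opprB sqrrN.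
Qed.

(** Both deformed densities are translates of [e^(u_y) p^W'] and [p^W'], whose
    integrals are at most [1]: the weight [e^(u_y + h_y)] leaves a factor
    [e^(- s h_y)] in front. *)
Lemma le_integral_mixing_field (y : V) :
  (\int[mixing_field e W i0]_u (expR (s * field_of u y))%:E <=
   (expR (\sum_(p in directed_edges e)
            q * (W p.1 p.2 + 1) * (h p.2 - h p.1) ^+ 2 - s * h y))%:E)%E.
Proof.
have [s0 s1] := andP s01.
have mp w : measurable_fun setT
    (fun t : n.-tuple R => mixing_density e w i0 (field_of (i0 := i0) t)).
  exact: measurable_mixing_density.
have mu b : measurable_fun setT (fun t : n.-tuple R => field_of (i0 := i0) t b).
  exact: measurable_field_of.
have p0 w (v : V -> R) : 0 <= mixing_density e w i0 v.
  exact: mixing_density_ge0.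
rewrite (@ge0_integral_with_density _ _ _ (lebesgue_tuple R n)
   (mixing_field e W i0) (fun t => mixing_density e W i0 (field_of t)))//; last first.
  apply/measurable_EFinP; apply: measurableT_comp => //.
  by apply: measurable_funM => //; exact: mu.
pose F b (t : n.-tuple R) := expR (field_of (i0 := i0) t b) *
  mixing_density e W' i0 (field_of (i0 := i0) t).
have mF b : measurable_fun setT (F b).
  by apply: measurable_funM => //; apply: measurableT_comp => //; exact: mu.
have F0 b t : 0 <= F b t by rewrite mulr_ge0 ?expR_ge0 ?p0.
have F_le c b : (\int[lebesgue_tuple R n]_t (F b (tuple_add t (shift c)))%:E <= 1)%E.
  rewrite (ge0_integral_tuple_translation (shift c) (F := EFin \o F b))//.
  - exact: le_integral_mixing_density.
  - exact/measurable_EFinP.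
  - by move=> t; rewrite lee_fin.
have mFs c b : measurable_fun setT
    (fun t : n.-tuple R => (F b (tuple_add t (shift c)))%:E).
  apply/measurable_EFinP; apply: measurableT_comp => //.
  exact: measurable_tuple_addr.
set K := expR _.
have K0 : 0 <= K by exact: expR_ge0.
apply: (@le_trans _ _ (\int[lebesgue_tuple R n]_t (K%:E *
   (s%:E * (F y (tuple_add t (shift 1)))%:E +
    (1 - s)%:E * (F i0 (tuple_add t (shift (- q))))%:E)))%E).
  apply: ge0_le_integral => //.
  - by move=> t _; rewrite -EFinM lee_fin mulr_ge0 ?expR_ge0 ?p0.
  - apply/measurable_EFinP; apply: measurable_funM => //.
    apply: measurableT_comp => //; apply: measurable_funM => //; exact: mu.
  - by apply: measurable_funeM; apply: emeasurable_funD; exact: measurable_funeM.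
  move=> t _; rewrite -!EFinM lee_fin.
  have := @mixing_density_deformation_le R V e W i0 W_ge0 s q h s01 erefl h_le
    (field_of t) y; move=> /le_trans; apply.
  have hE c : field_of (i0 := i0) (tuple_add t (shift c)) =
      fun b => field_of (i0 := i0) t b + c * h b.
    by apply/funext => b; exact: field_of_shift.
  rewrite /F !hE h_root mulr0 addr0 field_of_root expR0 !mul1r.
  have -> : (fun b => field_of t b + 1 * h b) = (fun b => field_of t b + h b).
    by apply/funext => b; rewrite mul1r.
  have -> : (fun b => field_of t b + - q * h b) =
            (fun b => field_of t b - q * h b).
    by apply/funext => b; rewrite mulNr.
  rewrite /K; set M := s * _ + _.
  rewrite (_ : _ / 2 = \sum_(p in directed_edges e)
            q * (W p.1 p.2 + 1) * (h p.2 - h p.1) ^+ 2)//.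
  rewrite -big_split/= mulr_suml; apply: eq_bigr => p _; by field.
have s0' := ltW s0; have t0 : 0 <= 1 - s by rewrite subr_ge0 ltW.
have m1 : measurable_fun setT (fun t : n.-tuple R =>
    (s%:E * (F y (tuple_add t (shift 1)))%:E)%E) by exact: measurable_funeM.
have m2 : measurable_fun setT (fun t : n.-tuple R =>
    ((1 - s)%:E * (F i0 (tuple_add t (shift (- q))))%:E)%E).
  exact: measurable_funeM.
have n1 x : (0 <= s%:E * (F y (tuple_add x (shift 1)))%:E)%E.
  by rewrite mule_ge0 ?lee_fin.
have n2 x : (0 <= (1 - s)%:E * (F i0 (tuple_add x (shift (- q))))%:E)%E.
  by rewrite mule_ge0 ?lee_fin.
rewrite (@ge0_integralZl _ _ _ (lebesgue_tuple R n) _ measurableT _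
  (emeasurable_funD m1 m2)) ?lee_fin//; last first.
  by move=> t _; rewrite adde_ge0.
rewrite -[leRHS]mule1 lee_wpmul2l ?lee_fin//.
rewrite (ge0_integralD (lebesgue_tuple R n) measurableT _ m1 _ m2)//.
rewrite (ge0_integralZl (lebesgue_tuple R n) measurableT (mFs _ _))//; last first.
  by move=> t _; rewrite lee_fin.
rewrite (ge0_integralZl (lebesgue_tuple R n) measurableT (mFs _ _))//; last first.
  by move=> t _; rewrite lee_fin.
apply: (@le_trans _ _ (s%:E * 1 + (1 - s)%:E * 1)%E).
  by apply: leeD; apply: lee_wpmul2l => //; rewrite lee_fin.
by rewrite !mule1 -EFinD addrC subrK.
Qed.

End deformation_bound.

(** * The wired box *)

Lemma neighbor_sym : symmetric neighbor.
Proof. by move=> i j; rewrite /neighbor; lia. Qed.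

Lemma neighbor_sup_norm i j : neighbor i j -> (sup_norm j <= (sup_norm i).+1)%N.
Proof. by rewrite /neighbor /sup_norm; lia. Qed.

Definition neighbors (i : Z2) : seq Z2 :=
  [:: (i.1 + 1, i.2); (i.1 - 1, i.2); (i.1, i.2 + 1); (i.1, i.2 - 1)].

Lemma mem_neighbors (i j : Z2) : neighbor i j -> j \in neighbors i.
Proof.
case: i j => [a b] [a' b']; rewrite /neighbor /= => ab.
have : [\/ a' = a + 1 /\ b' = b, a' = a - 1 /\ b' = b,
          a' = a /\ b' = b + 1 | a' = a /\ b' = b - 1].
  have : (a' = a + 1 /\ b' = b) \/ (a' = a - 1 /\ b' = b) \/
         (a' = a /\ b' = b + 1) \/ (a' = a /\ b' = b - 1) by lia.
  by move=> [|[|[|]]] ?; [apply: Or41|apply: Or42|apply: Or43|apply: Or44].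
by case=> -[-> ->]; rewrite !inE eqxx ?orbT.
Qed.

Definition sphere_seq (k : nat) : seq Z2 :=
  let J := [seq i%:Z - k%:Z | i <- iota 0 k.*2.+1] in
  [seq (k%:Z, j) | j <- J] ++ [seq (- k%:Z, j) | j <- J] ++
  [seq (j, k%:Z) | j <- J] ++ [seq (j, - k%:Z) | j <- J].

Lemma size_sphere_seq k : (size (sphere_seq k.+1) <= 12 * k.+1)%N.
Proof. by rewrite !size_cat !size_map !size_iota; lia. Qed.

Lemma mem_sphere_seq i : i \in sphere_seq (sup_norm i).
Proof.
case: i => a b; rewrite /sphere_seq; set k := sup_norm _.
set J : seq int := [seq i%:Z - k%:Z | i <- iota 0 k.*2.+1].
have inJ (c : int) : (`|c| <= k)%N -> c \in J.
  move=> ck; apply/mapP; exists (absz (c + k%:Z)); last by lia.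
  by rewrite mem_iota; lia.
have ak : (`|a| <= k)%N by rewrite /k /sup_norm /=; lia.
have bk : (`|b| <= k)%N by rewrite /k /sup_norm /=; lia.
have : [\/ a = k%:Z, a = - k%:Z, b = k%:Z | b = - k%:Z].
  have : (k = `|a|)%N \/ (k = `|b|)%N by rewrite /k /sup_norm /=; lia.
  clearbody k; move=> [->|->].
    case: (ltrP a 0) => a0; [apply: Or42|apply: Or41]; lia.
  case: (ltrP b 0) => b0; [apply: Or44|apply: Or43]; lia.
clearbody k; rewrite !mem_cat -/J.
have inl (c : int) d : (`|d| <= k)%N -> (c, d) \in [seq (c, j) | j <- J].
  by move=> dk; apply: map_f; exact: inJ.
have inr (c : int) d : (`|d| <= k)%N -> (d, c) \in [seq (j, c) | j <- J].
  by move=> dk; apply: (map_f (pair^~ c)); exact: inJ.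
by case=> ->; rewrite ?(inl _ _ bk) ?(inr _ _ ak) ?orbT.
Qed.

Lemma card_sphere N k :
  (#|[pred x : box N | sup_norm (val x) == k.+1]| <= 12 * k.+1)%N.
Proof.
apply: leq_trans (size_sphere_seq k); rewrite cardE -(size_map val).
apply: uniq_leq_size; first by rewrite map_inj_uniq ?enum_uniq//; exact: val_inj.
move=> i /mapP[x]; rewrite mem_enum inE => /eqP xk ->.
by rewrite -xk mem_sphere_seq.
Qed.

Section harmonic.
Context (R : realType).

Definition harmonic_sum (k : nat) : R := \sum_(j < k) j.+1%:R^-1.

Lemma harmonic_sumS k : harmonic_sum k.+1 = harmonic_sum k + k.+1%:R^-1.
Proof. by rewrite /harmonic_sum big_ord_recr. Qed.

Lemma harmonic_sum_ge0 k : 0 <= harmonic_sum k.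
Proof. by apply: sumr_ge0 => j _; rewrite invr_ge0. Qed.

Lemma ln_le_harmonic_sum k : ln k.+1%:R <= harmonic_sum k.
Proof.
elim: k => [|k IH]; first by rewrite ln1 harmonic_sum_ge0.
have -> : k.+2%:R = k.+1%:R * (1 + k.+1%:R^-1) :> R.
  by rewrite mulrDr mulfV ?pnatr_eq0// mulr1 natr1.
rewrite lnM ?posrE ?ltr_wpDr ?invr_ge0// harmonic_sumS lerD//.
by apply: le_ln1Dx; rewrite (lt_le_trans (ltrN10 _))// invr_ge0.
Qed.

End harmonic.

Section wired.
Context (R : realType) (N : nat) (W : Z2 -> Z2 -> R).
Hypothesis W_sym : forall i j, neighbor i j -> W i j = W j i.
Hypothesis W_gt0 : forall i j, neighbor i j -> 0 < W i j.

Local Notation e := (@wired_edge N).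
Local Notation pr := (wired_proj N).
Local Notation Wn := (wired_conductance W).

Lemma wired_edge_sym : symmetric e.
Proof.
move=> a b; rewrite /wired_edge eq_sym; congr (_ && _).
by apply/asboolP/asboolP => -[i [j [ij ia jb]]]; exists j, i; rewrite neighbor_sym.
Qed.

Lemma wired_edgeP a b : e a b ->
  a != b /\ exists i j, [/\ neighbor i j, pr i = a & pr j = b].
Proof. by move=> /andP[ab /asboolP]. Qed.

Lemma wired_conductance_ge0 (a b : wired_vertex N) : 0 <= Wn a b.
Proof. by apply: fsumr_ge0 => p [/W_gt0/ltW]. Qed.

Lemma wired_conductance_sym (a b : wired_vertex N) : Wn a b = Wn b a.
Proof.
rewrite /wired_conductance.
rewrite (reindex_fsbig (fun p : Z2 * Z2 => (p.2, p.1))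
  [set p : Z2 * Z2 | [/\ neighbor p.1 p.2, pr p.1 = b & pr p.2 = a]])/=; last first.
  split.
  - by move=> -[i j] /= [ij ib ja]; rewrite neighbor_sym.
  - by move=> -[i j] [k l] _ _ /= [-> ->].
  - by move=> -[i j] /= [ij ia jb]; exists (j, i) => //=; rewrite neighbor_sym.
by apply: eq_fsbigr => -[i j]; rewrite inE /= => -[ij _ _]; rewrite W_sym// neighbor_sym.
Qed.

Lemma wired_proj_Some (x : box N) : pr (val x) = Some x.
Proof. by rewrite /wired_proj valK. Qed.

Lemma wired_proj_SomeP i (x : box N) : pr i = Some x -> i = val x.
Proof. by rewrite /wired_proj; case: insubP => // y _ yi [<-]. Qed.

Lemma wired_conductance_Some (x y : box N) : neighbor (val x) (val y) ->
  Wn (Some x) (Some y) = W (val x) (val y).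
Proof.
move=> xy; rewrite /wired_conductance (_ : mkset _ = [set (val x, val y)]).
  by rewrite fsbig_set1.
apply/seteqP; split => [[i j] [/= _ /wired_proj_SomeP -> /wired_proj_SomeP ->] //|].
by move=> p -> /=; rewrite !wired_proj_Some.
Qed.

Lemma card_wired_edge (x : box N) : (#|[pred b | e (Some x) b]| <= 4)%N.
Proof.
rewrite cardE; apply: (@leq_trans (size (map pr (neighbors (val x))))) => //.
apply: uniq_leq_size; first exact: enum_uniq.
move=> b; rewrite mem_enum inE => /wired_edgeP[_ [i [j [ij /wired_proj_SomeP ix jb]]]].
by rewrite -jb map_f// -ix; exact: mem_neighbors.
Qed.

Variable r : nat.
Hypothesis r_le : (r <= N)%N.

(** The sup norm cut off at [r], which extends to the wired point because all the
    contracted vertices have norm larger than [N >= r]. *)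
Definition capped_norm (a : wired_vertex N) : nat :=
  if a is Some x then minn (sup_norm (val x)) r else r.

Lemma capped_norm_proj i : capped_norm (pr i) = minn (sup_norm i) r.
Proof.
rewrite /wired_proj /capped_norm; case: insubP => [x _ -> //|].
by rewrite in_box; lia.
Qed.

(** [k ^ -2] on the sphere of radius [k], for [0 < k <= r]: up to a constant, the
    share of a vertex in the Dirichlet energy of the profile below. *)
Definition sphere_weight (a : wired_vertex N) : R :=
  if a is Some x then
    \sum_(k < r) (sup_norm (val x) == k.+1)%:R * k.+1%:R^-1 ^+ 2
  else 0.

Lemma sphere_weight_ge0 a : 0 <= sphere_weight a.
Proof.
by case: a => //= x; apply: sumr_ge0 => k _; rewrite mulr_ge0 ?sqr_ge0.
Qed.

(** The sphere of radius [k] has at most [12 k] points. *)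
Lemma sum_sphere_weight :
  \sum_a sphere_weight a <= 12 * harmonic_sum R r.
Proof.
rewrite (bigD1 None)//= add0r (reindex_omap Some id)/=; last by case.
rewrite (eq_bigl predT) => [|x]; last by rewrite eqxx.
rewrite exchange_big/= mulr_sumr; apply: ler_sum => k _.
rewrite -mulr_suml expr2 mulrA ler_wpM2r ?invr_ge0//.
rewrite ler_pdivrMr// -natr_sum.
have := card_sphere N k; rewrite -sum1_card big_mkcond/= => h.
rewrite -natrM ler_nat; apply: leq_trans h.
by apply: leq_sum => x _; rewrite inE; case: (_ == _).
Qed.

Variables (c : R).
Hypothesis c_ge0 : 0 <= c.

(** A discrete version of [c * ln |x|], cut off at norm [r]. *)
Definition log_profile (a : wired_vertex N) : R :=
  c * harmonic_sum R (capped_norm a).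

(** Along an edge where the capped norm increases it is not capped at the lower end,
    so that the upper end lies on the sphere of radius [capped_norm b]. *)
Let capped_norm_step a b : e a b -> (capped_norm a < capped_norm b)%N ->
  capped_norm b = (capped_norm a).+1 /\
  (capped_norm b)%:R^-1 ^+ 2 <= sphere_weight b.
Proof.
move=> /wired_edgeP[_ [i [j [ij <- <-]]]]; rewrite !capped_norm_proj => lt_ij.
have := neighbor_sup_norm ij => j_le.
have iE : minn (sup_norm i) r = sup_norm i by lia.
have jE : minn (sup_norm j) r = (sup_norm i).+1 by lia.
rewrite iE jE; split=> //.
have jN : j \in box N by rewrite in_box; lia.
rewrite -[j]/(val [` jN]%fset) wired_proj_Some /sphere_weight /=.
have ir : (sup_norm i < r)%N by lia.
rewrite (bigD1 (Ordinal ir))//= (_ : (sup_norm j == _) = true); last by lia.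
by rewrite mul1r lerDl sumr_ge0// => k _; rewrite mulr_ge0 ?sqr_ge0.
Qed.

Lemma log_profile_step a b : e a b ->
  `|log_profile b - log_profile a| <= c /\
  (log_profile b - log_profile a) ^+ 2 <=
    c ^+ 2 * (sphere_weight a + sphere_weight b).
Proof.
wlog le_ab : a b / (capped_norm a <= capped_norm b)%N => [hw eab|].
  have [/hw/(_ eab)//|ba] := leqP (capped_norm a) (capped_norm b).
  rewrite distrC -[log_profile b - _]opprB sqrrN [sphere_weight a + _]addrC.
  by apply: hw; [exact: ltnW | rewrite wired_edge_sym].
move=> eab; move: le_ab; rewrite leq_eqVlt => /predU1P[abE|lt_ab].
  rewrite /log_profile abE subrr normr0 expr0n/=; split=> //.
  by rewrite mulr_ge0 ?sqr_ge0// addr_ge0// sphere_weight_ge0.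
have [bE wb] := capped_norm_step eab lt_ab.
have -> : log_profile b - log_profile a = c * (capped_norm b)%:R^-1.
  by rewrite /log_profile bE harmonic_sumS; ring.
split.
  rewrite normrM (ger0_norm c_ge0) -[leRHS]mulr1 ler_wpM2l// ger0_norm ?invr_ge0//.
  by rewrite bE invf_le1// ler1n.
rewrite exprMn ler_wpM2l ?sqr_ge0//; apply: (le_trans wb).
by rewrite lerDr sphere_weight_ge0.
Qed.

(** At the wired point the profile has gradient [0]; all other edges are edges of the
    lattice with their own conductance. *)
Lemma log_profile_conductance (Wmax : R) a b :
  (forall i j, neighbor i j -> W i j <= Wmax) -> 0 <= Wmax -> e a b ->
  Wn a b * (log_profile b - log_profile a) ^+ 2 <=
  Wmax * (log_profile b - log_profile a) ^+ 2.
Proof.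
move=> W_le Wmax0 eab.
have [/eqP|d0] := eqVneq (log_profile b - log_profile a) 0.
  by move=> /eqP ->; rewrite expr0n/= !mulr0.
have [ab [i [j [ij ia jb]]]] := wired_edgeP eab.
rewrite ler_wpM2r ?sqr_ge0//.
have [aN bN] : i \in box N /\ j \in box N.
  have cab : capped_norm a != capped_norm b.
    by apply: contra d0 => /eqP abE; rewrite /log_profile abE subrr.
  have := neighbor_sup_norm ij.
  have : neighbor j i by rewrite neighbor_sym.
  move=> /neighbor_sup_norm.
  move: cab; rewrite -ia -jb !capped_norm_proj !in_box; lia.
have iE : i = val [` aN]%fset by [].
have jE : j = val [` bN]%fset by [].
rewrite iE jE in ij ia jb; rewrite !wired_proj_Some in ia jb.
by rewrite -ia -jb wired_conductance_Some// W_le.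
Qed.

(** Charge each edge to its endpoints, each of which has at most [4] neighbors. *)
Lemma sum_log_profile :
  \sum_(p in directed_edges e) (log_profile p.2 - log_profile p.1) ^+ 2 <=
  96 * c ^+ 2 * harmonic_sum R r.
Proof.
pose g a b := if e a b then sphere_weight a else 0.
have g_le : \sum_a \sum_b g a b <= 48 * harmonic_sum R r.
  apply: (@le_trans _ _ (\sum_a 4 * sphere_weight a)).
    apply: ler_sum => -[x|] _; last first.
      by rewrite big1 ?mulr0// => b _; rewrite /g; case: ifP.
    rewrite /g -big_mkcond sumr_const -[leLHS]mulr_natl.
    by rewrite ler_wpM2r ?sphere_weight_ge0// ler_nat card_wired_edge.
  by rewrite -mulr_sumr; have := sum_sphere_weight; lra.
apply: (@le_trans _ _ (\sum_a \sum_b c ^+ 2 * (g a b + g b a))).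
  rewrite pair_bigA big_mkcond/=; apply: ler_sum => -[a b] _; rewrite inE/=.
  case: ifP => eab.
    by rewrite /g [e b a]wired_edge_sym eab; have [] := log_profile_step eab.
  by rewrite /g [e b a]wired_edge_sym eab addr0 mulr0.
under eq_bigr do rewrite -mulr_sumr big_split/=.
rewrite -mulr_sumr big_split/= [X in _ + X]exchange_big/=.
move: g_le; set G := \sum_a _; have := sqr_ge0 c; nra.
Qed.

End wired.

(** * Polynomial decay *)

Theorem theorem1 (R : realType) (Wmax : R) (s : R) (hs0 : 0 < s) (hs1 : s < 1) :
  exists eta : R, 0 < eta /\
  forall W : Z2 -> Z2 -> R,
    (forall i j, neighbor i j -> W i j = W j i) ->
    (forall i j, neighbor i j -> 0 < W i j) ->
    (forall i j, neighbor i j -> W i j <= Wmax) ->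
  exists N0 : nat, forall N : nat, (N0 <= N)%N ->
  forall y : Z2, y \in box N -> y != 0 ->
    (\int[wired_field N W]_u (expR (s * field_of u (wired_proj N y)))%:E
       <= ((sup_norm y)%:R `^ (- eta))%:E)%E.
Proof.
pose M := Num.max Wmax 0; have M0 : 0 <= M by rewrite le_max lexx orbT.
(* small enough for the energy [q * (M + 1) * 96 * c ^+ 2 * H_r] of the profile to be
   half of the gain [s * c * H_r], and for the gradients to be at most [1 / 2] *)
pose c := (1 - s) / (192 * (M + 1)).
have t0 : 0 < 1 - s by rewrite subr_gt0.
have M1 : 0 < M + 1 by rewrite ltr_wpDl.
have c0 : 0 < c by rewrite divr_gt0// mulr_gt0.
exists (s * c / 2); split; first by rewrite divr_gt0// mulr_gt0.
move=> W W_sym W_gt0 W_le; exists 0%N => N _ y yN y_neq0.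
have {}W_le i j : neighbor i j -> W i j <= M.
  by move=> /W_le /le_trans; apply; rewrite le_max lexx.
pose r := sup_norm y.
have rN : (r <= N)%N by rewrite -in_box.
have r0 : (0 < r)%N.
  rewrite lt0n; apply: contraNneq y_neq0; rewrite /r; clear.
  by case: y => a b; rewrite /sup_norm /= => ab; apply/eqP; congr pair; lia.
pose h : wired_vertex N -> R := log_profile r c.
pose q := s / (1 - s).
have q0 : 0 < q by rewrite divr_gt0.
have qcE : q * c = s / (192 * (M + 1)).
  by rewrite /q /c; field; rewrite !gt_eqF.
have c_le : c <= 1 / 2.
  by rewrite /c ler_pdivrMr ?mulr_gt0//; lra.
have qc_le : q * c <= 1 / 2.
  by rewrite qcE ler_pdivrMr ?mulr_gt0//; lra.
have h_root : h (wired_proj N 0) = 0.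
  by rewrite /h /log_profile capped_norm_proj// min0n /harmonic_sum big_ord0 mulr0.
have h_y : h (wired_proj N y) = c * harmonic_sum R r.
  by rewrite /h /log_profile capped_norm_proj// minnn.
have h_step i j : wired_edge i j ->
    h j - h i <= 1 / 2 /\ - (q * (h j - h i)) <= 1 / 2.
  move=> ij; have [+ _] := log_profile_step rN (ltW c0) ij.
  rewrite -/(h _) -/(h _) ler_norml => /andP[h1 h2]; split.
    exact: le_trans c_le.
  apply: le_trans qc_le; rewrite -mulrN ler_wpM2l ?(ltW q0)//; lra.
apply: le_trans.
  apply: (@le_integral_mixing_field R _ (@wired_edge N) (wired_conductance W)
    (wired_proj N 0) _ _ (@wired_edge_sym N) s h _ h_root h_step).
  - by move=> i j _; exact: wired_conductance_ge0.
  - by move=> i j _; exact: wired_conductance_sym.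
  - by rewrite hs0.
rewrite lee_fin h_y /powR gt_eqF ?ltr0n// ler_expR -/q.
have sum_le : \sum_(p in directed_edges (@wired_edge N))
    q * (wired_conductance W p.1 p.2 + 1) * (h p.2 - h p.1) ^+ 2 <=
    q * (M + 1) * (96 * c ^+ 2 * harmonic_sum R r).
  apply: (@le_trans _ _ (\sum_(p in directed_edges (@wired_edge N))
     q * (M + 1) * (h p.2 - h p.1) ^+ 2)).
    apply: ler_sum => -[a b]; rewrite inE /= => ab.
    have := log_profile_conductance rN (ltW c0) W_le M0 ab.
    rewrite -/(h _) -/(h _) => hab.
    rewrite -mulrA -[leRHS]mulrA; apply: ler_wpM2l; first exact: ltW.
    by rewrite [leLHS]mulrDl [leRHS]mulrDl lerD.
  rewrite -mulr_sumr; apply: ler_wpM2l; first exact/ltW/mulr_gt0.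
    exact: (sum_log_profile rN (ltW c0)).
have KE : q * (M + 1) * (96 * c ^+ 2) = s * c / 2.
  transitivity (q * c * (M + 1) * 96 * c); first by ring.
  by rewrite qcE; field; rewrite gt_eqF.
have ln_le : ln r%:R <= harmonic_sum R r.
  apply: le_trans (ln_le_harmonic_sum R r).
  by rewrite ler_ln ?posrE ?ltr0n// ler_nat.
move: sum_le; rewrite [X in _ <= X -> _]mulrA KE => sum_le.
have := ler_wpM2l (ltW (divr_gt0 (mulr_gt0 hs0 c0) (ltr0n _ 2))) ln_le.
lra.
Qed.
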